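(* There exist a field $\mathcal{F}$ and a positive integer $n$ such that the commuting graph $\Gamma(\mathcal{F},n)$ of the matrix algebra $\operatorname{Mat}_n(\mathcal{F})$ is connected and has diameter equal to six.
   Context: For a field $\mathbb{F}$ and a positive integer $n$, $\operatorname{Mat}_n(\mathbb{F})$ is the algebra of $n\times n$ matrices over $\mathbb{F}$. The commuting graph $\Gamma(\mathbb{F},n)$ has as vertices the non-scalar matrices in $\operatorname{Mat}_n(\mathbb{F})$ (matrices not of the form $\lambda I$ with $\lambda\in\mathbb{F}$), and its edges are the pairs $(U,V)$ of vertices satisfying $UV=VU$. The distance between two vertices is the number of edges in a shortest path joining them, and the diameter is the supremum of the distances between pairs of vertices. *)

(* Defs.v *)
From mathcomp Require Import all_boot all_algebra.

Set Implicit Arguments.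
Unset Strict Implicit.
Unset Printing Implicit Defensive.

Section Graph.

Variables (T : Type) (e : rel T).

(* Vertices may repeat along p; this does not affect the shortest length. *)
Definition walk (x y : T) (p : seq T) : Prop := path e x p /\ last x p = y.

Definition graph_connected : Prop := forall x y : T, exists p, walk x y p.

(* Distances and diameters live in the extended naturals, [option nat] with
   [None] as infinity, so that disconnected graphs are covered too. *)
Definition enat_le (a b : option nat) : bool :=
  match a, b with
  | _, None => true
  | None, Some _ => false
  | Some m, Some n => m <= n
  end.

Definition is_distance (x y : T) (d : option nat) : Prop :=
  match d with
  | Some k => (exists2 p, walk x y p & size p = k) /\
              (forall p, walk x y p -> k <= size p)
  | None => forall p, ~ walk x y p
  end.

Definition distance_bound (b : option nat) : Prop :=
  forall x y d, is_distance x y d -> enat_le d b.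

Definition is_diameter (D : option nat) : Prop :=
  distance_bound D /\ (forall b, distance_bound b -> enat_le D b).

End Graph.

Definition commuting_vertex (F : fieldType) (n : nat) : Type :=
  {A : 'M[F]_n | ~~ is_scalar_mx A}.

(* As in the pairs (U, V) with UV = VU, loops are not excluded; they do not
   affect connectedness or distances. *)
Definition commuting_graph (F : fieldType) (n : nat) :
    rel (commuting_vertex F n) :=
  fun U V => comm_mxb (val U) (val V).

(* Main.v *)
Require Import Defs.
From HB Require Import structures.
From mathcomp Require Import all_boot all_order all_algebra all_fingroup all_solvable all_field.
From mathcomp Require Import boolp classical_sets ring zify.

(** Take n = 2d with d = 23, and L / F cyclic of degree d with generator s and an
    element e of L such that e * s(e) is not a square. Let A be multiplication by
    sqrt e on L^2 = L(sqrt e) and let B be a conjugate g A g^-1.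

    Lower bound: the only field strictly between F and L(sqrt e) is L, so the
    neighbours of the neighbours of A (resp. of B) lie in M_2(L) (resp. in
    g M_2(L) g^-1). For g = (1 + E12 (s^3 + s^9)) (1 + E21 s), comparing the
    coefficients of the powers of s in a commutation relation shows that commuting
    elements of these two algebras are scalar on one side; so no walk from A to B
    has length 5.

    Upper bound: if every F-field of degree 2d generated by a matrix has a proper
    intermediate field, then each non-scalar matrix commutes with a non-scalar A'
    which either has rank at most d or generates a field of degree at most d. Given
    two such A', B', a suitable matrix of rank one is at distance two from both.

    The field F is a maximal subfield of the algebraic numbers such that
    u = 2 cos (2 k pi / 47) is not in F and e * s(e) is not a square in L = F(u),
    where s(u) = u^2 - 2 and e = u - r for a rational r between u and s(u); the
    rationals qualify because e * s(e) < 0. If N / F has degree 2d and does not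
    contain u, maximality puts a square root of e * s(e), hence also of its
    conjugate, in N(u), so that N(u) / L, of degree 2d, has a subfield of degree 4,
    which is absurd as d is odd. *)

Set Implicit Arguments.
Unset Strict Implicit.
Unset Printing Implicit Defensive.

Import GRing.Theory.
Local Open Scope ring_scope.

(** * Cyclic extensions *)

Section CyclicExtension.

Variables (F : fieldType) (L : splittingFieldType F) (s : gal_of {:L}%AS) (d : nat).
Hypothesis d_prime : prime d.
Hypothesis s_order : #[s]%g = d.
Hypothesis s_fixed : forall x : L, s x = x -> x \in 1%VS.

Local Notation sg i := (s ^+ i)%g.
Local Notation baseP := (map_poly (in_alg L)).

Lemma galpow_add i j x : (sg (i + j)) x = (sg j) (sg i x).
Proof. by rewrite expgD galM ?memvf. Qed.

Lemma galpow_mod i x : sg (i %% d)%N x = sg i x.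
Proof. by rewrite -s_order expg_mod_order. Qed.

(** [i] is invertible modulo the prime [d], so [s] is itself a power of [sg i]. *)
Lemma galpow_fixed i (x : L) : ~~ (d %| i)%N -> sg i x = x -> x \in 1%VS.
Proof.
move=> ndi fx; apply: s_fixed.
have co : coprime i d by rewrite coprime_sym prime_coprime.
have [u v /= e _] := egcdnP i (prime_gt0 d_prime).
have fxm k : sg (i * k) x = x.
  elim: k => [|k IH]; first by rewrite muln0 expg0 gal_id.
  by rewrite mulnS galpow_add fx.
have i_gt0 : (0 < i)%N by case: (i) ndi; rewrite ?dvdn0.
have [u' v' e' _] := egcdnP d i_gt0.
move: e'; rewrite (eqP co) => e'.
have := fxm u'; rewrite mulnC e' galpow_add -(galpow_mod (v' * d)) modnMl expg0 gal_id.
by rewrite expg1.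
Qed.

Lemma galpow_inj i j : (i < d)%N -> (j < d)%N -> sg i = sg j -> i = j.
Proof.
move=> id jd /eqP; rewrite eq_expg_mod_order s_order !modn_small //.
by move/eqP.
Qed.

Lemma map_gal_base i (p : {poly F}) : map_poly (sg i) (baseP p) = baseP p.
Proof.
rewrite -map_poly_comp; apply: eq_map_poly => x /=.
by rewrite rmorph_alg.
Qed.

Lemma fixed_poly (p : {poly L}) : map_poly s p = p -> exists q, p = baseP q.
Proof.
move=> fp.
have /polyOver1P[q ->] : p \is a polyOver 1%VS.
  by apply/polyOverP => i; apply: s_fixed; rewrite -[in RHS]fp coef_map.
by exists q.
Qed.

Lemma map_galpowS i (p : {poly L}) :
  map_poly s (map_poly (sg i) p) = map_poly (sg i.+1) p.
Proof.
rewrite -map_poly_comp; apply: eq_map_poly => x /=.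
by rewrite -addn1 galpow_add expg1.
Qed.

Lemma map_galpow_mod i (p : {poly L}) :
  map_poly (sg (i %% d)%N) p = map_poly (sg i) p.
Proof. by apply: eq_map_poly => x; rewrite galpow_mod. Qed.

Lemma map_galpow_fixed i (p : {poly L}) : ~~ (d %| i)%N ->
  map_poly (sg i) p = p -> map_poly s p = p.
Proof.
move=> ndi fp; apply/polyP=> k; rewrite coef_map.
have : p`_k \in 1%VS.
  by apply: (galpow_fixed ndi); rewrite -[in RHS]fp coef_map.
by case/vlineP=> a ->; exact: (rmorph_alg s).
Qed.

Lemma map_galpow_add i j (p : {poly L}) :
  map_poly (sg (i + j)) p = map_poly (sg j) (map_poly (sg i) p).
Proof. by rewrite -map_poly_comp; apply: eq_map_poly => x /=; rewrite galpow_add. Qed.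

(* Chinese remaindering: [P] is congruent to the i-th conjugate of [l] modulo
   the i-th conjugate of [h]. *)
Lemma conjugate_interpolation (h : {poly L}) (l : L) :
  irreducible_poly h -> h \is monic -> map_poly s h != h ->
  exists P : {poly F}, h %| baseP P - l%:P.
Proof.
move=> h_irr h_mon h_mov.
have d_gt0 := prime_gt0 d_prime.
pose H i := map_poly (sg i) h.
have H_irr i : irreducible_poly (H i).
  split=> [|q q1 qH]; first by rewrite size_map_poly; case: h_irr.
  (* The inverse power of [s] carries [H i] back to [h], so a divisor of [H i] gives a divisor of
     [h]. *)
  have e : map_poly (sg (d - i %% d)%N) (H i) = h.
    rewrite -map_galpow_add -map_galpow_mod.
    rewrite -modnDml addnC subnK ?modnn; last by rewrite ltnW ?ltn_mod.
    by rewrite (_ : sg 0 = 1%g) ?map_poly_id // => x _; rewrite gal_id.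
  have := qH; rewrite -(dvdp_map (sg (d - i %% d)%N)) e => /h_irr.2.
  by rewrite size_map_poly => /(_ q1); rewrite -{1}e eqp_map.
have H_mon i : H i \is monic by rewrite monic_map.
have H_neq i : (0 < i < d)%N -> H i != h.
  case/andP=> i0 id; apply: contraNneq h_mov => e; apply/eqP.
  by apply: (@map_galpow_fixed i); rewrite // gtnNdvd.
have H_cop i : (0 < i < d)%N -> coprimep h (H i).
  move=> hi; rewrite irreducible_poly_coprime //.
  apply: contra (H_neq _ hi) => hH.
  have := (H_irr i).2 h.
  rewrite gtn_eqF; last by case: h_irr.
  by move/(_ isT hH); rewrite eqp_monic // eq_sym.
pose G := \prod_(1 <= i < d) H i.
have /Bezout_eq1_coprimepP[[a b] /= ab1] : coprimep h G.
  rewrite /G big_seq; apply: (big_ind (fun g => coprimep h g)).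
  - exact: coprimep1.
  - by move=> x y hx hy; rewrite coprimepMr hx.
  - by move=> i; rewrite mem_index_iota => /H_cop.
(* [Q] is congruent to [l] modulo [h] and divisible by the other conjugates of [h], so only the
   first term of the trace [S] survives modulo [h]. *)
pose Q := l *: (b * G).
pose S := \sum_(i < d) map_poly (sg i) Q.
have [P eP] : exists P, S = baseP P.
  apply: fixed_poly; rewrite /S rmorph_sum /=.
  under eq_bigr do rewrite map_galpowS.
  case: (d) (d_gt0) (s_order) => // e _ oe.
  rewrite big_ord_recr big_ord_recl /= addrC; congr (_ + _).
  by rewrite -oe expg_order expg0.
exists P; rewrite -eP /S.
case ed: (d) d_gt0 => [//|e] _.
rewrite big_ord_recl /= expg0.
rewrite (_ : map_poly _ Q = Q); last by rewrite map_poly_id // => x _; rewrite gal_id.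
rewrite addrAC; apply: dvdp_add.
  have -> : Q - l%:P = - (l *: (a * h)).
    by rewrite /Q -[X in _ - X]mulr1 -ab1 mul_polyC scalerDr opprD addrC addrNK.
  by rewrite dvdpNr -mul_polyC !dvdp_mull.
apply: (big_ind (fun g => h %| g)).
- exact: dvdp0.
- exact: dvdp_add.
- move=> i _; rewrite /Q map_polyZ rmorphM /= -mul_polyC !dvdp_mull //.
  rewrite /G rmorph_prod /=.
  (* The factor [H k] of [G] with k = d - (i + 1) becomes [h] under the power i + 1 of [s]. *)
  pose k := (d - (bump 0 i))%N.
  have hk : (0 < k < d)%N.
    by rewrite /k /bump ed /= add1n subn_gt0 ltnS ltn_ord subSS ltnS leq_subr.
  have ek : (k + bump 0 i = d)%N by rewrite /k subnK // ed /bump add1n ltnS ltnW.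
  rewrite (bigD1_seq k) ?mem_index_iota ?iota_uniq //=; apply: dvdp_mulr.
  rewrite /H -map_galpow_add ek -s_order expg_order.
  by rewrite map_poly_id // => x _; rewrite gal_id.
Qed.

End CyclicExtension.

(** * Skew polynomials *)

Lemma matrix2P (R : nzRingType) (A B : 'M[R]_2) :
  A 0 0 = B 0 0 -> A 0 1 = B 0 1 -> A 1 0 = B 1 0 -> A 1 1 = B 1 1 -> A = B.
Proof.
move=> e00 e01 e10 e11; apply/matrixP => i j.
have H (k : 'I_2) : k = 0 \/ k = 1 by case: k => [[|[|//]] ?]; [left|right]; exact: val_inj.
by case: (H i) => ->; case: (H j) => ->.
Qed.

Lemma mulmx2E (R : nzRingType) (A B : 'M[R]_2) i j :
  (A *m B) i j = A i 0 * B 0 j + A i 1 * B 1 j.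
Proof.
rewrite mxE !big_ord_recl big_ord0 addr0.
by congr (_ * _ + _ * _); congr (_ _ _); apply: val_inj.
Qed.

Lemma delta2E (R : nzRingType) : ((delta_mx 0 1 : 'M[R]_2) 0 0 = 0) *
  ((delta_mx 0 1 : 'M[R]_2) 0 1 = 1) * ((delta_mx 0 1 : 'M[R]_2) 1 0 = 0) *
  ((delta_mx 0 1 : 'M[R]_2) 1 1 = 0) * ((delta_mx 1 0 : 'M[R]_2) 0 0 = 0) *
  ((delta_mx 1 0 : 'M[R]_2) 0 1 = 0) * ((delta_mx 1 0 : 'M[R]_2) 1 0 = 1) *
  ((delta_mx 1 0 : 'M[R]_2) 1 1 = 0).
Proof. by do !split; rewrite mxE. Qed.

Lemma addmxE (R : nzRingType) m n (A B : 'M[R]_(m, n)) i j : (A + B) i j = A i j + B i j.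
Proof. by rewrite mxE. Qed.
Lemma oppmxE (R : nzRingType) m n (A : 'M[R]_(m, n)) i j : (- A) i j = - A i j.
Proof. by rewrite mxE. Qed.
Lemma scalemxE (R : nzRingType) m n a (A : 'M[R]_(m, n)) i j : (a *: A) i j = a * A i j.
Proof. by rewrite mxE. Qed.

Section SkewPolynomials.

Variables (F : fieldType) (L : splittingFieldType F) (s : gal_of {:L}%AS) (d : nat).
Hypothesis s_order : #[s]%g = d.

Local Notation sg i := (s ^+ i)%g.

(** Dedekind independence: the automorphisms are distinct, their exponents being distinct and below
    the order of [s]. *)
Lemma galpow_independent (I : eqType) (r : seq I) (k : I -> nat) (c : I -> L) :
  uniq [seq k i | i <- r] -> {in r, forall i, (k i < d)%N} ->
  (forall a, \sum_(i <- r) c i * sg (k i) a = 0) -> {in r, forall i, c i = 0}.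
Proof.
move=> r_uniq r_lt c0 i ir.
pose c' (x : gal_of {:L}%AS) := \sum_(j <- r | sg (k j) == x) c j.
have c'0 : c' (sg (k i)) = 0.
  apply: (@gal_independent _ _ _ predT c') => // a _.
  rewrite -[RHS](c0 a) /c'.
  under eq_bigr do rewrite mulr_suml.
  rewrite (exchange_big_dep predT) //=; apply: eq_bigr => j _.
  by rewrite (big_pred1 (sg (k j))) // => x; rewrite eq_sym.
have ru : uniq r by apply: map_uniq r_uniq.
rewrite -c'0 /c' big_mkcond (bigD1_seq i) //= eqxx big_seq_cond big1 ?addr0 // => j /andP[jr ji].
case: eqP => // e; case/eqP: ji.
have kji := galpow_inj s_order (r_lt _ jr) (r_lt _ ir) e.
have: index j r == index i r; last by move/eqP/index_inj; apply.
rewrite -(nth_uniq 0%N _ _ r_uniq) ?size_map ?index_mem //.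
by rewrite !(nth_map j) ?index_mem // !nth_index // kji.
Qed.

Local Notation app i v := (map_mx (sg i) v).

Lemma app_comp m n i j (M : 'M[L]_(m, n)) : app i (app j M) = app (i + j) M.
Proof. by apply/matrixP => a b; rewrite !mxE addnC galpow_add. Qed.

(** In skew polynomials, terms of degrees [i] and [j] multiply to degree i + j. These sums are
    distinct and below [d], so independence splits the commutation relation into one relation per
    pair. *)
Lemma homogeneous_commute (n : nat) (I J : seq nat) (X Y : nat -> 'M[L]_n) :
  uniq [seq (i + j)%N | i <- I, j <- J] ->
  all (fun k => k < d)%N [seq (i + j)%N | i <- I, j <- J] ->
  (forall v : 'cV[L]_n,
     \sum_(i <- I) X i *m app i (\sum_(j <- J) Y j *m app j v) =
     \sum_(j <- J) Y j *m app j (\sum_(i <- I) X i *m app i v)) ->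
  forall i j, i \in I -> j \in J -> X i *m app i (Y j) = Y j *m app j (X i).
Proof.
move=> IJu IJd com i j iI jJ; apply/eqP; rewrite -subr_eq0; apply/eqP/matrixP => a b.
pose D (p : nat * nat) := X p.1 *m app p.1 (Y p.2) - Y p.2 *m app p.2 (X p.1).
rewrite -/(D (i, j)) [RHS]mxE.
pose r := [seq (i, j) | i <- I, j <- J].
have er : [seq p.1 + p.2 | p <- r]%N = [seq (i + j)%N | i <- I, j <- J].
  by rewrite /r map_allpairs.
apply: (@galpow_independent _ r (fun p => (p.1 + p.2)%N) (fun p => D p a b)).
- by rewrite er.
- move=> p pr; apply: (allP IJd); rewrite -er.
  by apply/mapP; exists p.
- move=> x.
  (* On x times the basis vector [b], coordinate [a] of the relation is a linear combination of
     powers of [s] applied to x. *)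
  have /eqP := com (x *: delta_mx b 0); rewrite -subr_eq0 => /eqP/matrixP/(_ a 0).
  rewrite [RHS]mxE => e0; rewrite -[RHS]e0 {e0}.
  rewrite (_ : \sum_(p <- I) _ = \sum_(p <- I) \sum_(q <- J)
      X p *m app p (Y q *m app q (x *: delta_mx b 0))); last first.
    by apply: eq_bigr => p _; rewrite raddf_sum mulmx_sumr.
  rewrite (_ : \sum_(q <- J) _ = \sum_(p <- I) \sum_(q <- J)
      Y q *m app q (X p *m app p (x *: delta_mx b 0))); last first.
    by rewrite exchange_big; apply: eq_bigr => q _; rewrite raddf_sum mulmx_sumr.
  rewrite -sumrB summxE.
  rewrite /r; rewrite [LHS]big_allpairs; apply: eq_bigr => p _.
  rewrite -sumrB summxE; apply: eq_bigr => q _ /=.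
  rewrite !map_mxM !app_comp !mulmxA (addnC q p) -mulmxBl -/(D (p, q)).
  rewrite map_mxZ map_delta_mx -scalemxAr [RHS]mxE mulrC.
  by congr (_ * _); rewrite -colE [RHS]mxE.
- by apply/allpairsP; exists (i, j).
Qed.

Local Notation E12 := (delta_mx 0 1 : 'M[L]_2).
Local Notation E21 := (delta_mx 1 0 : 'M[L]_2).

(* The exponents 0, 3, 6, 9, 12, 18 of [shear1^-1 X shear1] and 0, 1, 2 of
   [shear2 Y shear2^-1] have pairwise distinct sums, all at most 20. *)
Definition shear1 (v : 'cV[L]_2) := v + E12 *m (app 3 v + app 9 v).
Definition shear1_inv (v : 'cV[L]_2) := v - E12 *m (app 3 v + app 9 v).
Definition shear2 (v : 'cV[L]_2) := v + E21 *m app 1 v.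
Definition shear2_inv (v : 'cV[L]_2) := v - E21 *m app 1 v.

Lemma shear1K : cancel shear1 shear1_inv.
Proof.
move=> v; rewrite /shear1_inv /shear1 !map_mxD !map_mxM !map_delta_mx !mulmxDr !mulmxA.
by rewrite mul_delta_mx_0 // !mul0mx !addr0 addrK.
Qed.

Lemma shear1_invK : cancel shear1_inv shear1.
Proof.
move=> v; rewrite /shear1_inv /shear1 !map_mxB !map_mxM !map_delta_mx !mulmxDr !mulmxN !mulmxA.
by rewrite mul_delta_mx_0 // !mul0mx !subr0 subrK.
Qed.

Lemma shear2K : cancel shear2 shear2_inv.
Proof.
move=> v; rewrite /shear2_inv /shear2 !map_mxD !map_mxM !map_delta_mx !mulmxDr !mulmxA.
by rewrite mul_delta_mx_0 // !mul0mx !addr0 addrK.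
Qed.

Lemma shear2_invK : cancel shear2_inv shear2.
Proof.
move=> v; rewrite /shear2_inv /shear2 !map_mxB !map_mxM !map_delta_mx !mulmxDr !mulmxN !mulmxA.
by rewrite mul_delta_mx_0 // !mul0mx !subr0 subrK.
Qed.

(** The coefficient of the [i]-th power of [s] in (1 - E12 (s^3 + s^9)) X (1 + E12 (s^3 + s^9)). *)
Definition shear1_component (X : 'M[L]_2) (i : nat) : 'M[L]_2 :=
  match i with
  | 0 => X
  | 3 => X *m E12 - E12 *m app 3 X
  | 6 => - (E12 *m app 3 X *m E12)
  | 9 => X *m E12 - E12 *m app 9 X
  | 12 => - (E12 *m app 3 X *m E12) - E12 *m app 9 X *m E12
  | 18 => - (E12 *m app 9 X *m E12)
  | _ => 0
  end.

(** The coefficient of the [j]-th power of [s] in (1 + E21 s) Y (1 - E21 s). *)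
Definition shear2_component (Y : 'M[L]_2) (j : nat) : 'M[L]_2 :=
  match j with
  | 0 => Y
  | 1 => E21 *m app 1 Y - Y *m E21
  | 2 => - (E21 *m app 1 Y *m E21)
  | _ => 0
  end.

Lemma app0 m n (M : 'M[L]_(m, n)) : app 0 M = M.
Proof. by apply/matrixP => a b; rewrite mxE expg0 gal_id. Qed.

Lemma shear1_conj X v : shear1_inv (X *m shear1 v) =
  \sum_(i <- [:: 0; 3; 6; 9; 12; 18]%N) shear1_component X i *m app i v.
Proof.
rewrite !big_cons big_nil addr0 /= app0.
rewrite /shear1 /shear1_inv !(mulmxDr, map_mxD, map_mxM, map_delta_mx, app_comp).
rewrite !addnE /= !(mulmxDl, mulmxBl, mulNmx) !mulmxA.
do ![move: (_ *m app _ v) => ?].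
by apply/matrixP => r c; rewrite !mxE; ring.
Qed.

Lemma shear2_conj Y v : shear2 (Y *m shear2_inv v) =
  \sum_(j <- [:: 0; 1; 2]%N) shear2_component Y j *m app j v.
Proof.
rewrite !big_cons big_nil addr0 /= app0.
rewrite /shear2 /shear2_inv !(mulmxDr, mulmxN, map_mxD, map_mxN, map_mxM, map_delta_mx, app_comp).
rewrite !addnE /= !(mulmxDl, mulmxBl, mulNmx, mulmxN) !mulmxA.
do ![move: (_ *m app _ v) => ?].
by apply/matrixP => r c; rewrite !mxE; ring.
Qed.
End SkewPolynomials.

(** * Commuting elements of the two sheared matrix algebras *)

Section SkewCommutant.

Variables (F : fieldType) (L : splittingFieldType F) (s : gal_of {:L}%AS) (d : nat).
Hypothesis d_prime : prime d.
Hypothesis s_order : #[s]%g = d.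
Hypothesis s_fixed : forall x : L, s x = x -> x \in 1%VS.

Local Notation sg i := (s ^+ i)%g.
Local Notation app i v := (map_mx (sg i) v).
Local Notation E12 := (delta_mx 0 1 : 'M[L]_2).
Local Notation E21 := (delta_mx 1 0 : 'M[L]_2).
Hypothesis d_gt20 : (20 < d)%N.

Lemma appmxE i m n (A : 'M[L]_(m, n)) a b : (app i A) a b = sg i (A a b).
Proof. by rewrite mxE. Qed.

Let simp := (addmxE, oppmxE, scalemxE, appmxE, mulmx2E, delta2E,
  mulr0, mul0r, mulr1, mul1r, addr0, add0r, subr0, sub0r, oppr0, rmorph0, rmorph1).

(** The relations for [j] = 2 and 0 kill [Y 0 1] and [Y 1 0]; those for 1 and 0 say that s carries
    [Y 0 0] to [Y 1 1] and s^i carries [Y 1 1] to [Y 0 0]. So s^(i+1) fixes [Y 1 1], which is then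
    in F. *)
Lemma commute_elementary (c : L) i (Y : 'M[L]_2) : c != 0 -> (i.+1 < d)%N ->
  (forall j, j \in [:: 0; 1; 2]%N ->
    (c *: E12) *m app i (shear2_component s Y j) =
    shear2_component s Y j *m app j (c *: E12)) ->
  exists a : F, Y = (a%:A)%:M.
Proof.
move=> c0 id H.
have gi0 k (x : L) : sg k x = 0 -> x = 0 by move/eqP; rewrite fmorph_eq0 => /eqP.
have ci0 k (x : L) : c * sg k x = 0 -> x = 0.
  by move/eqP; rewrite mulf_eq0 (negPf c0) => /eqP/gi0.
have y2 : Y 0 1 = 0.
  have /matrixP/(_ 0 0) := H 2%N isT; rewrite /= !simp => /ci0/eqP.
  by rewrite oppr_eq0 => /eqP/gi0.
have y4 : Y 1 1 = sg 1 (Y 0 0).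
  have /matrixP/(_ 0 0) := H 1%N isT; rewrite /= !simp => /ci0/eqP.
  by rewrite subr_eq0 => /eqP.
have y3 : Y 1 0 = 0.
  by have /matrixP/(_ 0 0) := H 0%N isT; rewrite /= !simp => /ci0.
have y1 : Y 0 0 = sg i (Y 1 1).
  have /matrixP/(_ 0 1) := H 0%N isT; rewrite /= !simp expg0 gal_id mulrC => /(mulIf c0) ->.
  by [].
have : Y 1 1 \in 1%VS.
  apply: (@galpow_fixed _ _ _ _ d_prime s_order s_fixed i.+1); first by rewrite gtnNdvd.
  by rewrite -addn1 galpow_add -y1 -y4.
case/vlineP => a ya; exists a; apply: matrix2P; rewrite ?y1 ?y2 ?y3 ?ya !mxE //=.
exact: rmorph_alg.
Qed.

(** If the component of X of degree 3, 6 or 9 is a non-zero multiple of [E12], then Y is scalar by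
    [commute_elementary]. If not, X is upper triangular with a single element of F on its diagonal,
    and its component of degree 0 serves instead. *)
Lemma shear_commutant (X Y : 'M[L]_2) :
  (forall v, shear1_inv s (X *m shear1 s (shear2 s (Y *m shear2_inv s v))) =
             shear2 s (Y *m shear2_inv s (shear1_inv s (X *m shear1 s v)))) ->
  (exists a : F, X = (a%:A)%:M) \/ (exists a : F, Y = (a%:A)%:M).
Proof.
move=> com.
have H i j : i \in [:: 0; 3; 6; 9; 12; 18]%N -> j \in [:: 0; 1; 2]%N ->
  shear1_component s X i *m app i (shear2_component s Y j) =
  shear2_component s Y j *m app j (shear1_component s X i).
  apply: (homogeneous_commute s_order) => //.
    by rewrite /=; do ![rewrite (leq_trans _ d_gt20) //].
  by move=> v; rewrite -!shear1_conj -!shear2_conj com.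
have K c i : c != 0 -> i \in [:: 3; 6; 9]%N -> shear1_component s X i = c *: E12 ->
  exists a : F, Y = (a%:A)%:M.
  move=> c0 hi e; apply: (@commute_elementary c i) => //.
    by apply: leq_trans d_gt20; move: hi; rewrite !inE => /or3P[]/eqP->.
  by move=> j hj; rewrite -e; apply: H => //; move: hi; rewrite !inE => /or3P[]/eqP->.
have [x3|x3] := eqVneq (X 1 0) 0; last first.
  right; apply: (@K (- sg 3 (X 1 0)) 6%N) => //.
    by rewrite oppr_eq0 fmorph_eq0.
  by apply: matrix2P; rewrite !simp.
have C3 : shear1_component s X 3 = (X 0 0 - sg 3 (X 1 1)) *: E12.
  by apply: matrix2P; rewrite /= !simp ?x3 ?rmorph0 ?subr0 ?oppr0.
have C9 : shear1_component s X 9 = (X 0 0 - sg 9 (X 1 1)) *: E12.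
  by apply: matrix2P; rewrite /= !simp ?x3 ?rmorph0 ?subr0 ?oppr0.
have [e3|n3] := eqVneq (X 0 0 - sg 3 (X 1 1)) 0; last by right; exact: K C3.
have [e9|n9] := eqVneq (X 0 0 - sg 9 (X 1 1)) 0; last by right; exact: K C9.
move/eqP: e3 e9; rewrite subr_eq0 => /eqP e3 /eqP; rewrite subr_eq0 => /eqP e9.
(* Both s^3 and s^9 carry [X 1 1] to [X 0 0], so s^6 fixes [X 0 0]. *)
have : X 0 0 \in 1%VS.
  apply: (@galpow_fixed _ _ _ _ d_prime s_order s_fixed 6).
    by rewrite gtnNdvd // (leq_trans _ d_gt20).
  by rewrite {1}e3 -galpow_add addnC -e9.
case/vlineP => a xa.
have x4 : X 1 1 = a%:A.
  have: sg 3 (X 1 1) = sg 3 a%:A by rewrite -e3 xa; symmetry; exact: rmorph_alg.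
  exact: fmorph_inj.
have [x2|x2] := eqVneq (X 0 1) 0.
  by left; exists a; apply: matrix2P; rewrite ?xa ?x2 ?x3 ?x4 !mxE.
right; apply: (@commute_elementary (X 0 1) 0) => // [|j hj].
  exact: leq_trans d_gt20.
(* The scalar [a] of F satisfies the same relations, so X may be replaced by X - a, a multiple of
   [E12]. *)
have XE : X 0 1 *: E12 = X - (a%:A)%:M.
  by apply: matrix2P; rewrite !simp ?xa ?x3 ?x4 !mxE /= ?subr0 ?subrr.
rewrite XE raddfB mulmxBl mulmxBr (H 0%N j) //=; congr (_ - _).
have aj : sg j (a%:A) = a%:A := rmorph_alg _ _.
by rewrite app0 map_scalar_mx [X in _ *m X%:M]aj scalar_mxC.
Qed.

End SkewCommutant.

(** * Matrices far apart *)

Section Transport.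

Variables (F : fieldType) (L : splittingFieldType F) (s : gal_of {:L}%AS) (d : nat).
Hypothesis d_prime : prime d.
Hypothesis s_order : #[s]%g = d.
Hypothesis s_fixed : forall x : L, s x = x -> x \in 1%VS.
Hypothesis d_gt20 : (20 < d)%N.

Local Notation sg i := (s ^+ i)%g.
Local Notation baseP := (map_poly (in_alg L)).
Local Notation E12 := (delta_mx 0 1 : 'M[L]_2).
Local Notation E21 := (delta_mx 1 0 : 'M[L]_2).

Variables (N : nat).
Local Notation n := N.+1.
Variables (enc : 'cV[L]_2 -> 'rV[F]_n) (dec : 'rV[F]_n -> 'cV[L]_2).
Hypothesis encK : cancel enc dec.
Hypothesis decK : cancel dec enc.
Local Notation flin f := (forall (a : F) u v, f ((a%:A : L) *: u + v) = (a%:A : L) *: f u + f v).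
Hypothesis enc_lin : forall (a : F) u v, enc ((a%:A : L) *: u + v) = a *: enc u + enc v.

(** * Matrices over F as F-linear maps of L^2 *)

Lemma dec_lin (a : F) u v : dec (a *: u + v) = (a%:A : L) *: dec u + dec v.
Proof. by apply: (can_inj encK); rewrite enc_lin !decK. Qed.

(** Matrices multiply row vectors on the right, so [act] reverses products. *)
Definition act (A : 'M[F]_n) (v : 'cV[L]_2) := dec (enc v *m A).

Lemma act_flin A : flin (act A).
Proof. by move=> a u v; rewrite /act enc_lin mulmxDl -scalemxAl dec_lin. Qed.

Lemma act_mul A B v : act (A *m B) v = act B (act A v).
Proof. by rewrite /act decK mulmxA. Qed.

Lemma act_inj A B : act A =1 act B -> A = B.
Proof.
move=> e; apply/row_matrixP => i; rewrite !rowE.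
by have := e (dec (delta_mx 0 i)); rewrite /act decK => /(can_inj decK).
Qed.

Lemma act_commP A B : comm_mx A B <-> (forall v, act A (act B v) = act B (act A v)).
Proof.
split=> [c v|c]; first by rewrite -!act_mul c.
by apply: act_inj => v; rewrite !act_mul c.
Qed.

Lemma act_scalar (a : F) v : act a%:M v = (a%:A : L) *: v.
Proof.
rewrite /act mul_mx_scalar -[X in dec X]addr0 dec_lin encK.
have := dec_lin 1 0 0; rewrite scaler0 !add0r !scale1r => /esym/eqP.
by rewrite -subr_eq0 addrK => /eqP ->; rewrite addr0.
Qed.

Lemma mx_of_flin (f : 'cV[L]_2 -> 'cV[L]_2) : flin f -> {A : 'M[F]_n | act A =1 f}.
Proof.
move=> f_lin; pose h u := enc (f (dec u)).
have h_lin : linear h by move=> a u v; rewrite /h dec_lin f_lin enc_lin.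
pose hL : {linear 'rV[F]_n -> 'rV[F]_n} := HB.pack h (GRing.isLinear.Build _ _ _ _ h h_lin).
by exists (lin1_mx hL) => v; rewrite /act mul_rV_lin1 /= /h !encK.
Qed.

Lemma act_scalarP A : reflect (exists a : F, act A =1 (fun v => (a%:A : L) *: v)) (is_scalar_mx A).
Proof.
apply: (iffP is_scalar_mxP) => [[a ->]|[a e]]; exists a; first exact: act_scalar.
by apply: act_inj => v; rewrite e act_scalar.
Qed.

Lemma flinD (f : 'cV[L]_2 -> 'cV[L]_2) : flin f -> {morph f : u v / u + v}.
Proof. by move=> fl u v; have := fl 1 u v; rewrite !scale1r. Qed.

Lemma flin0 (f : 'cV[L]_2 -> 'cV[L]_2) : flin f -> f 0 = 0.
Proof. by move=> fl; apply: (@addrI _ (f 0)); rewrite -flinD ?addr0. Qed.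

Lemma flinZ (f : 'cV[L]_2 -> 'cV[L]_2) (a : F) u : flin f -> f ((a%:A : L) *: u) = (a%:A : L) *: f u.
Proof. by move=> fl; rewrite -[X in f X]addr0 fl flin0 ?addr0. Qed.

Lemma flin_poly (f : 'cV[L]_2 -> 'cV[L]_2) (x : L) (P : {poly F}) : flin f ->
  (forall v, f (x *: v) = x *: f v) ->
  forall v, f ((baseP P).[x] *: v) = (baseP P).[x] *: f v.
Proof.
move=> fl fx v; elim/poly_ind: P => [|P a IH] //.
  by rewrite rmorph0 horner0 !scale0r flin0.
rewrite rmorphD rmorphM /= map_polyX map_polyC !hornerE !scalerDl flinD //.
by rewrite flinZ // mulrC -!scalerA fx IH.
Qed.

(** Interpolation modulo X - x writes every [l] as P(x) with P over F: an element moved by [s]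
    generates L. *)
Lemma flin_moved (f : 'cV[L]_2 -> 'cV[L]_2) (x : L) : flin f -> s x != x ->
  (forall v, f (x *: v) = x *: f v) -> forall l v, f (l *: v) = l *: f v.
Proof.
move=> fl xm fx l v.
have [||/=|P] := conjugate_interpolation d_prime s_order s_fixed (h := 'X - x%:P) l.
- exact: irredp_XsubC.
- exact: monicXsubC.
- by rewrite map_polyXsubC (inj_eq (addrI _)) eqr_opp (inj_eq polyC_inj).
rewrite dvdp_XsubCl => /rootP; rewrite !hornerE => /eqP; rewrite subr_eq0 => /eqP <-.
exact: flin_poly.
Qed.

Lemma matrix_of_linear (f : 'cV[L]_2 -> 'cV[L]_2) :
  (forall u v, f (u + v) = f u + f v) ->
  (forall (l : L) v, f (l *: v) = l *: f v) ->
  {M : 'M[L]_2 | forall v : 'cV[L]_2, f v = M *m v :> 'cV[L]_2}.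
Proof.
move=> fD fZ.
exists (\matrix_(i, j) f (delta_mx j 0) i 0) => v.
have e : v = v 0 0 *: delta_mx 0 0 + v 1 0 *: delta_mx 1 0.
  rewrite {1}[v]matrix_sum_delta !big_ord_recl !big_ord0 !addr0.
  by congr (v _ _ *: delta_mx _ _ + v _ _ *: delta_mx _ _); exact: val_inj.
rewrite [in LHS]e fD !fZ; apply/colP => i; rewrite !mxE !big_ord_recl big_ord0 addr0 !mxE mulrC.
congr (_ + _); rewrite mulrC; congr (f (delta_mx _ _) _ _ * v _ _); exact: val_inj.
Qed.

Lemma act_horner A (M : 'M[L]_2) (P : {poly F}) : (forall v, act A v = M *m v) ->
  forall v, act (horner_mx A P) v = horner_mx M (baseP P) *m v.
Proof.
move=> AM v; elim/poly_ind: P v => [|P a IH] v //.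
  have z : (0 : 'M[F]_n) = 0%:M by rewrite raddf0.
  by rewrite !rmorph0 mul0mx z act_scalar !scale0r.
rewrite !rmorphD !rmorphM /= map_polyX map_polyC !horner_mx_X !horner_mx_C /=.
have -> : act (horner_mx A P * A + a%:M) v = act (horner_mx A P * A) v + act a%:M v.
  by rewrite /act mulmxDr -[X in dec (X + _)]scale1r dec_lin !scale1r.
rewrite act_mul AM IH act_scalar mulmxDl mul_scalar_mx mulmxA; congr (_ *m _ + _).
exact: comm_mx_horner.
Qed.

(** * Second neighbours of the square root of e *)

Variable e : L.
Hypothesis char_neq2 : (2 : L) != 0.
Hypothesis e_nonsquare : forall x : L, x ^+ 2 != e * s e.

Lemma e_moved : s e != e.
Proof. by apply/eqP=> se; have := e_nonsquare e; rewrite se expr2 eqxx. Qed.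

Lemma e_not_square x : x ^+ 2 != e.
Proof. by apply/eqP=> xe; have := e_nonsquare (x * s x); rewrite exprMn -rmorphXn /= xe eqxx. Qed.

(** Multiplication by sqrt e on L(sqrt e), in the basis 1, sqrt e. *)
Definition sqrt_mx : 'M[L]_2 := e *: E12 + E21.

Lemma sqrt_mxK : sqrt_mx *m sqrt_mx = e%:M.
Proof.
by apply: matrix2P; rewrite mulmx2E !addmxE !scalemxE !delta2E !mxE /=; ring.
Qed.

(** Commuting with [sqrt_mx] implies commuting with its square [e], which is moved by [s]. *)
Lemma sqrt_mx_flin (f : 'cV[L]_2 -> 'cV[L]_2) : flin f ->
  (forall v, f (sqrt_mx *m v) = sqrt_mx *m f v) ->
  forall l v, f (l *: v) = l *: f v.
Proof.
move=> fl fs; apply: (flin_moved fl e_moved) => v.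
by rewrite -!mul_scalar_mx -sqrt_mxK -!mulmxA !fs.
Qed.

Definition L_linear (Z : 'M[F]_n) := forall l v, act Z (l *: v) = l *: act Z v.

(* Every non-scalar element of the field [L(sqrt e)] generates a subfield containing [L]. *)
Lemma sqrt_neighbor A X Z : act A =1 mulmx sqrt_mx -> ~~ is_scalar_mx X ->
  comm_mx A X -> comm_mx X Z -> L_linear Z.
Proof.
move=> AE Xns AX XZ.
have Xs v : act X (sqrt_mx *m v) = sqrt_mx *m act X v.
  by rewrite -!AE; move/act_commP: AX.
have XL := sqrt_mx_flin (@act_flin X) Xs.
have [M XM] := matrix_of_linear (flinD (@act_flin X)) XL.
have Ms : M *m sqrt_mx = sqrt_mx *m M.
  apply/matrixP => i j; have := Xs (delta_mx j 0); rewrite !XM !mulmxA -!colE.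
  by move/matrixP/(_ i 0); rewrite [LHS]mxE [RHS]mxE.
(* Commuting with [sqrt_mx] makes [M] equal to p + q sqrt e. *)
have M11 : M 1 1 = M 0 0.
  have /matrixP/(_ 1 0) := Ms; rewrite !mulmx2E !addmxE !scalemxE !delta2E.
  by rewrite !(mulr0, mul0r, mulr1, mul1r, add0r, addr0).
have M01 : M 0 1 = e * M 1 0.
  have /matrixP/(_ 0 0) := Ms; rewrite !mulmx2E !addmxE !scalemxE !delta2E.
  by rewrite !(mulr0, mul0r, mulr1, mul1r, add0r, addr0).
set p := M 0 0 in M11; set q := M 1 0 in M01.
have [q0|q0] := eqVneq q 0.
  have Mp : M = p%:M.
    by apply: matrix2P; rewrite ?M11 ?M01 -/p -/q ?q0 ?mulr0 !mxE.
  have [/s_fixed/vlineP[a pa]|pm] := eqVneq (s p) p.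
    case/negP: Xns; apply/act_scalarP; exists a => v.
    by rewrite XM Mp mul_scalar_mx pa.
  apply: (flin_moved (@act_flin Z) pm) => v.
  have /act_commP/(_ v) := XZ; rewrite !XM Mp !mul_scalar_mx => <-.
  by [].
pose h : {poly L} := 'X^2 - (2 * p) *: 'X + (p ^+ 2 - q ^+ 2 * e)%:P.
have h_size : size h = 3%N.
  rewrite /h -addrA size_polyDl size_polyXn // -size_polyN opprD opprK.
  apply: leq_ltn_trans (size_polyD _ _) _; rewrite gtn_max ltnS size_polyN.
  rewrite (leq_trans (size_scale_leq _ _)) ?size_polyX //=.
  by rewrite ltnS (leq_trans (size_polyC_leq1 _)).
have h_mon : h \is monic.
  rewrite monicE lead_coefE h_size /= /h !coefD coefN coefZ coefXn coefX coefC /=.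
  by rewrite mulr0 subr0 addr0.
have h_eval x : h.[x] = (x - p) ^+ 2 - q ^+ 2 * e.
  by rewrite /h !hornerE /=; ring.
have h_irr : irreducible_poly h.
  apply: cubic_irreducible => [|x]; first by rewrite h_size.
  apply/negP; rewrite /root h_eval subr_eq0 => /eqP xe.
  have := e_not_square ((x - p) / q); rewrite expr_div_n xe mulrAC divff ?mul1r ?eqxx //.
  by rewrite expf_eq0.
(* If [s] fixed [h], then s(p) = p and s(q)^2 s(e) = q^2 e, so e s(e) would be the square of s(q)
   s(e) / q. *)
have h_moved : map_poly s h != h.
  apply/eqP=> /polyP hs.
  have := hs 1%N; rewrite coef_map /h !coefD !coefN !coefZ !coefXn !coefX !coefC /=.
  rewrite !(mulr1, add0r, addr0) rmorphN rmorphM rmorphMn rmorph1 => /oppr_inj/(mulfI char_neq2) sp.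
  have := hs 0%N; rewrite coef_map /h !coefD !coefN !coefZ !coefXn !coefX !coefC /=.
  rewrite !(mulr0, subr0, oppr0, add0r) => hs0.
  have: s (p ^+ 2 - q ^+ 2 * e) = p ^+ 2 - q ^+ 2 * e := hs0.
  rewrite rmorphB !rmorphM /= sp => /addrI/oppr_inj sqe.
  have := e_nonsquare (s q * s e / q).
  rewrite (_ : _ ^+ 2 = s q * s q * s e * s e / q ^+ 2); last by field.
  by rewrite sqe (_ : _ / _ = e * s e) ?eqxx //; field.
move=> l v.
(* Interpolation modulo [h] yields P with P(X) acting as [l]; [Z] commutes with P(X). *)
have [P /dvdpP[k Pk]] := conjugate_interpolation d_prime s_order s_fixed l h_irr h_mon h_moved.
have hM : horner_mx M h = 0.
  rewrite /h rmorphD rmorphB /= linearZ /= horner_mx_C rmorphXn /= horner_mx_X.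
  apply: matrix2P; rewrite !addmxE !oppmxE expr2 mulmx2E !scalemxE ?M11 ?M01 -?/p -?/q !mxE /=; ring.
have PM : horner_mx M (baseP P) = l%:M.
  apply/eqP; rewrite -subr_eq0 -(horner_mx_C M) -rmorphB Pk rmorphM /= hM.
  by rewrite mulr0.
have PX w : act (horner_mx X P) w = l *: w by rewrite (act_horner _ XM) PM mul_scalar_mx.
have /act_commP PZ := comm_horner_mx P XZ.
by rewrite -!PX PZ.
Qed.

Lemma map_galpowZ j (a : F) (u : 'cV[L]_2) :
  map_mx (sg j) ((a%:A : L) *: u) = (a%:A : L) *: map_mx (sg j) u.
Proof. by rewrite map_mxZ; congr (_ *: _); exact: rmorph_alg. Qed.

Lemma shear1_flin : flin (shear1 s).
Proof.
move=> a u v.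
rewrite /shear1 !map_mxD !map_galpowZ addrACA -scalerDr mulmxDr -scalemxAr.
by rewrite addrACA -scalerDr.
Qed.

Lemma shear2_flin : flin (shear2 s).
Proof.
move=> a u v.
by rewrite /shear2 map_mxD map_galpowZ mulmxDr -scalemxAr addrACA -scalerDr.
Qed.

Lemma shear1_inv_flin : flin (shear1_inv s).
Proof.
move=> a u v; apply: (can_inj (shear1K s)); rewrite shear1_flin.
by rewrite !shear1_invK.
Qed.

Lemma shear2_inv_flin : flin (shear2_inv s).
Proof.
move=> a u v; apply: (can_inj (shear2K s)); rewrite shear2_flin.
by rewrite !shear2_invK.
Qed.

(** On a walk A, X1, X2, X3, X4, B, [sqrt_neighbor] makes [X2] L-linear and [X3] conjugate to an
    L-linear matrix; [shear_commutant] then makes one of them scalar. *)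
Theorem no_short_walk : exists A B : 'M[F]_n,
  [/\ ~~ is_scalar_mx A, ~~ is_scalar_mx B &
   forall X1 X2 X3 X4 : 'M[F]_n,
     ~~ is_scalar_mx X1 -> ~~ is_scalar_mx X2 -> ~~ is_scalar_mx X3 -> ~~ is_scalar_mx X4 ->
     comm_mx A X1 -> comm_mx X1 X2 -> comm_mx X2 X3 -> comm_mx X3 X4 -> comm_mx X4 B -> False].
Proof.
have mul_flin (M : 'M[L]_2) : flin (fun v : 'cV[L]_2 => M *m v).
  by move=> a u v; rewrite mulmxDr -scalemxAr.
have [A AE] := mx_of_flin (mul_flin sqrt_mx).
have [G GE] := mx_of_flin (f := shear1 s \o shear2 s) (fun a u v =>
  etrans (congr1 (shear1 s) (shear2_flin a u v)) (shear1_flin _ _ _)).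
have [H HE] := mx_of_flin (f := shear2_inv s \o shear1_inv s) (fun a u v =>
  etrans (congr1 (shear2_inv s) (shear1_inv_flin a u v)) (shear2_inv_flin _ _ _)).
have GH : G *m H = 1%:M.
  apply: act_inj => v; rewrite act_mul GE HE /= shear1K shear2K.
  by rewrite act_scalar scale1r scale1r.
have HG : H *m G = 1%:M by apply: mulmx1C.
pose conj X := G *m X *m H.
have conjK X : H *m conj X *m G = X.
  by rewrite /conj !mulmxA HG mul1mx -mulmxA HG mulmx1.
have conj_comm X Y : comm_mx X Y -> comm_mx (conj X) (conj Y).
  rewrite /comm_mx /conj => XY.
  have e1 U W : G *m U *m H *m (G *m W *m H) = G *m (U *m W) *m H.
    by rewrite !mulmxA -[_ *m H *m G]mulmxA HG mulmx1.
  by rewrite !e1 XY.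
have conj_ns X : ~~ is_scalar_mx X -> ~~ is_scalar_mx (conj X).
  apply: contra => /is_scalar_mxP[a Xa]; apply/is_scalar_mxP; exists a.
  by rewrite -[X]conjK Xa mul_mx_scalar -scalemxAl HG scalemx1.
have A_ns : ~~ is_scalar_mx A.
  apply/negP => /act_scalarP[a Aa].
  have := Aa (delta_mx 0 0); rewrite AE => /matrixP/(_ 1 0).
  rewrite -colE [LHS]mxE scalemxE [X in _ * X]mxE /= mulr0.
  rewrite /sqrt_mx addmxE scalemxE !delta2E mulr0 add0r => /eqP.
  by rewrite oner_eq0.
(* As [act] reverses products, this matrix acts as g A g^-1, where g is [shear1] after [shear2]. *)
exists A, (H *m A *m G); split => //.
  by apply: contra A_ns; rewrite -[in is_scalar_mx A](_ : conj (H *m A *m G) = A);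
    [move/is_scalar_mxP=> [a ->]; apply/is_scalar_mxP; exists a;
     rewrite /conj mul_mx_scalar -scalemxAl GH scalemx1
    |rewrite /conj !mulmxA GH mul1mx -mulmxA GH mulmx1].
move=> X1 X2 X3 X4 n1 n2 n3 n4 c1 c2 c3 c4 c5.
have XL2 := sqrt_neighbor AE n1 c1 c2.
have conjB : conj (H *m A *m G) = A.
  by rewrite /conj !mulmxA GH mul1mx -mulmxA GH mulmx1.
have XL3 : L_linear (conj X3).
  apply: (sqrt_neighbor AE (conj_ns _ n4)).
    by rewrite -conjB; apply: conj_comm; apply: comm_mx_sym.
  by apply: conj_comm; apply: comm_mx_sym.
have [M ME] := matrix_of_linear (flinD (@act_flin X2)) XL2.
have [M' ME'] := matrix_of_linear (flinD (@act_flin (conj X3))) XL3.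
have X3E v : act X3 v = shear1 s (shear2 s (M' *m shear2_inv s (shear1_inv s v))).
  by rewrite -[X3]conjK act_mul GE act_mul ME' HE.
have [] := @shear_commutant _ _ s d d_prime s_order s_fixed d_gt20 M M'.
(* Evaluating at [shear1 s v] and cancelling [shear1] moves the conjugation by [shear1] from [X3] to
   [X2]. *)
- move=> v; have /act_commP/(_ (shear1 s v)) := c3; rewrite !X3E !ME shear1K => ->.
  by rewrite shear1K.
- case=> a Ma; case/negP: n2; apply/act_scalarP; exists a => v.
  by rewrite ME Ma mul_scalar_mx.
- case=> a Ma; case/negP: (conj_ns _ n3); apply/act_scalarP; exists a => v.
  by rewrite ME' Ma mul_scalar_mx.
Qed.

End Transport.

(** * Walks of length six *)

Lemma irreducible_or_factor (R : fieldType) (p : {poly R}) : (1 < size p)%N ->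
  irreducible_poly p \/
  exists a b : {poly R}, [/\ p = a * b, (size a < size p)%N & (size b < size p)%N].
Proof.
move=> p1; have p0 : p != 0 by rewrite -size_poly_gt0 ltnW.
case: (pselect (exists q : {poly R}, [/\ size q != 1, q %| p & ~~ (q %= p)])) => [[q [q1 qp nqp]]|H].
  right; have /dvdpP[a pE] := qp; exists a, q.
  have : a * q != 0 by rewrite -pE.
  rewrite mulf_eq0 negb_or => /andP[a0 q0].
  have sq : (1 < size q)%N by rewrite ltn_neqAle eq_sym q1 size_poly_gt0.
  split=> //; first by rewrite pE size_mul //; case: (size q) sq => [|[|k]] // _; rewrite !addnS ltnS leq_addr.
  by rewrite ltn_neqAle dvdp_leq // andbT dvdp_size_eqp.
by left; split=> // q q1 qp; apply: contrapT => /negP nq; apply: H; exists q.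
Qed.

Section CommutingNeighbours.

Variables (F : fieldType) (N : nat).
Local Notation n := N.+1.
Implicit Types (A B X Z : 'M[F]_n) (v : 'rV[F]_n) (f : 'cV[F]_n) (p q : {poly F}).

(** * Cyclic subspaces and fields generated by one matrix *)

Lemma horner_mx_modp A p : horner_mx A (p %% mxminpoly A) = horner_mx A p.
Proof.
by rewrite [in RHS](divp_eq p (mxminpoly A)) rmorphD rmorphM /= mx_root_minpoly mulr0 add0r.
Qed.

(** Its row space is the cyclic subspace v F[A]. *)
Definition krylov A v := \matrix_(i < degree_mxminpoly A) (v *m (A ^+ i)).

Lemma mul_krylov A v (c : 'rV_(degree_mxminpoly A)) :
  c *m krylov A v = v *m horner_mx A (rVpoly c).
Proof.
rewrite mulmx_sum_row horner_rVpoly [c *m powers_mx _ _]mulmx_sum_row linear_sum mulmx_sumr.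
apply: eq_bigr => i _; rewrite linearZ /= -scalemxAr; congr (_ *: _).
by rewrite !rowK mxvecK.
Qed.

Lemma krylovP A v (x : 'rV[F]_n) :
  reflect (exists p, x = v *m horner_mx A p) (x <= krylov A v)%MS.
Proof.
apply: (iffP idP) => [/submxP[c ->]|[p ->]].
  by exists (rVpoly c); rewrite mul_krylov.
rewrite -horner_mx_modp.
set q := p %% _; have q_size : (size q <= degree_mxminpoly A)%N by apply: size_mod_mxminpoly.
by rewrite -[q](poly_rV_K q_size) -mul_krylov submxMl.
Qed.

Lemma self_krylov A v : (v <= krylov A v)%MS.
Proof. by apply/krylovP; exists 1; rewrite rmorph1 mulmx1. Qed.

(** The algebra F[A] is a field. *)
Definition fieldlike A := forall p, horner_mx A p = 0 \/ horner_mx A p \in unitmx.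

Lemma irreducible_fieldlike A : irreducible_poly (mxminpoly A) -> fieldlike A.
Proof.
move=> irr p; case: (boolP (mxminpoly A %| p)) => [/mxminpoly_minP|]; first by left.
rewrite -irreducible_poly_coprime // => /Bezout_eq1_coprimepP[[a b] /= ab]; right.
have : horner_mx A (a * mxminpoly A + b * p) = 1 by rewrite ab rmorph1.
rewrite rmorphD !rmorphM /= mx_root_minpoly mulr0 add0r => e.
by have /mulmx1_unit[] := e.
Qed.

Lemma horner_mx_comp A p q : horner_mx (horner_mx A p) q = horner_mx A (q \Po p).
Proof.
elim/poly_ind: q => [|q a IH]; first by rewrite comp_poly0 !rmorph0.
rewrite comp_polyD comp_polyM comp_polyX comp_polyC !rmorphD !rmorphM /= IH.
by rewrite horner_mx_X !horner_mx_C.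
Qed.

Lemma fieldlike_horner A p : fieldlike A -> fieldlike (horner_mx A p).
Proof. by move=> fA q; rewrite horner_mx_comp; apply: fA. Qed.

Lemma krylov_free A v : fieldlike A -> v != 0 -> row_free (krylov A v).
Proof.
move=> fA v0; apply: inj_row_free => c; rewrite mul_krylov => vc.
case: (fA (rVpoly c)) => [c0|cu]; last first.
  by case/eqP: v0; rewrite -[v](mulmxK cu) vc mul0mx.
by apply: (@horner_rVpoly_inj _ _ A); rewrite /= c0 !linear0.
Qed.

Lemma krylov_horner A v p : (krylov A v *m horner_mx A p <= krylov A v)%MS.
Proof.
apply/row_subP => i; rewrite row_mul rowK; apply/krylovP; exists ('X^i * p).
by rewrite rmorphM rmorphXn /= horner_mx_X mulmxA.
Qed.

(** For w outside v F[A], the subspaces v F[A] and w F[A] meet in 0 because F[A] is a field, and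
    both have the degree of A as dimension. *)
Lemma fieldlike_degree A : fieldlike A -> (degree_mxminpoly A < n)%N ->
  ((degree_mxminpoly A).*2 <= n)%N.
Proof.
move=> fA en; set e := degree_mxminpoly A in en *.
pose v : 'rV[F]_n := delta_mx 0 0.
have v0 : v != 0.
  by apply/eqP => /matrixP/(_ 0 0)/eqP; rewrite !mxE eqxx oner_eq0.
have /row_subPn[i w_out] : ~~ (1%:M <= krylov A v)%MS.
  by rewrite sub1mx /row_full (eqP (krylov_free fA v0)) neq_ltn en.
set w := row i 1%:M in w_out.
have w0 : w != 0 by apply: contraNneq w_out => ->; rewrite sub0mx.
have dis : (krylov A v :&: krylov A w)%MS = 0.
  apply/eqP; rewrite -submx0; apply/rV_subP => x.
  rewrite sub_capmx submx0 => /andP[xv /krylovP[q xq]].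
  case: (fA q) => [q0|qu]; first by rewrite xq q0 mulmx0.
  case/negP: w_out.
  have [_] := mxrank_leqif_sup (krylov_horner A v q).
  rewrite mxrankMfree ?row_free_unit // eqxx => /esym/idP sub.
  rewrite -(submxMfree _ _ (C := horner_mx A q)) ?row_free_unit // -xq.
  exact: submx_trans sub.
rewrite -addnn -[X in (X + _)%N](eqP (krylov_free fA v0)).
by rewrite -[X in (_ + X)%N](eqP (krylov_free fA w0)) -mxrank_disjoint_sum // rank_leq_col.
Qed.

(** The sum of A^i Z A^j over i + j = k - 1, that is, Z inserted in (x^k - y^k) / (x - y). *)
Fixpoint telescope A Z k : 'M[F]_n :=
  if k is k'.+1 then A *m telescope A Z k' + Z *m A ^+ k' else 0.

Lemma telescopeSr A Z k : telescope A Z k.+1 = telescope A Z k *m A + A ^+ k *m Z.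
Proof.
have S k' : telescope A Z k'.+1 = A *m telescope A Z k' + Z *m A ^+ k' by [].
elim: k => [|k IH]; first by rewrite S /= mulmx0 mul0mx mul1mx mulmx1.
rewrite S {1}IH mulmxDr S mulmxDl !mulmxA addrAC -!mulmxA.
have -> : A ^+ k *m A = A ^+ k.+1 by rewrite exprSr.
by have -> : A *m (A ^+ k *m Z) = A ^+ k.+1 *m Z by rewrite exprS mulmxA.
Qed.

Lemma telescope_comm A Z k :
  A *m telescope A Z k - telescope A Z k *m A = A ^+ k *m Z - Z *m A ^+ k.
Proof.
apply/eqP; rewrite subr_eq addrAC eq_sym subr_eq; apply/eqP.
by rewrite addrC -telescopeSr.
Qed.

Lemma mul_telescope A Z k : (forall i, Z *m A ^+ i *m Z = 0) -> Z *m telescope A Z k = 0.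
Proof.
move=> Z0; suff H j : Z *m A ^+ j *m telescope A Z k = 0 by rewrite -(H 0%N) mulmx1.
elim: k j => [|k IH] j /=; first by rewrite mulmx0.
rewrite mulmxDr !mulmxA Z0 mul0mx addr0 -[Z *m _ *m A]mulmxA.
by rewrite (_ : A ^+ j *m A = A ^+ j.+1) ?IH // exprSr.
Qed.

Lemma telescope_mul A Z k : (forall i, Z *m A ^+ i *m Z = 0) -> telescope A Z k *m Z = 0.
Proof.
move=> Z0; elim: k => [|k IH] /=; first by rewrite mul0mx.
by rewrite mulmxDl -mulmxA IH mulmx0 Z0 addr0.
Qed.

(* If m is the minimal polynomial of A, this is Z inserted in (m(x) - m(y)) / (x - y). *)
Definition divided_difference A Z :=
  \sum_(k < size (mxminpoly A)) (mxminpoly A)`_k *: telescope A Z k.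

(** By [telescope_comm] the commutator with A adds up to m(A) Z - Z m(A), where m is the minimal
    polynomial. *)
Lemma divided_difference_comm A Z : comm_mx A (divided_difference A Z).
Proof.
have hm (B C : 'M[F]_n) : \sum_(k < size (mxminpoly A)) (mxminpoly A)`_k *: (B *m A ^+ k *m C) = 0.
  rewrite -[RHS](_ : B *m horner_mx A (mxminpoly A) *m C = 0); last first.
    by rewrite mx_root_minpoly mulmx0 mul0mx.
  rewrite /horner_mx /horner_morph horner_coef size_map_poly_id0; last first.
    by rewrite (monicP (mxminpoly_monic A)) oner_eq0.
  rewrite mulmx_sumr mulmx_suml; apply: eq_bigr => k _.
  by rewrite coef_map /= -[_%:M * _]/(_ *m _) mul_scalar_mx -scalemxAr -scalemxAl.
apply/eqP; rewrite -subr_eq0 /divided_difference mulmx_sumr mulmx_suml -sumrB.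
under eq_bigr => k _ do
  rewrite -scalemxAr -scalemxAl -scalerBr telescope_comm scalerBr.
apply/eqP; rewrite sumrB -[RHS](subrr (0 : 'M[F]_n)); congr (_ - _).
  by rewrite -[RHS](hm 1%:M Z); apply: eq_bigr => k _; rewrite mul1mx.
by rewrite -[RHS](hm Z 1%:M); apply: eq_bigr => k _; rewrite mulmx1.
Qed.

(** A column [w] with v A^k w = 0 for k < deg m - 1 and v A^k w = 1 for k = deg m - 1 is killed by
    every term but the leading one, which sends it to [f]. *)
Lemma divided_difference_neq0 A v f : fieldlike A -> v != 0 -> f != 0 ->
  divided_difference A (f *m v) != 0.
Proof.
move=> fA v0 f0; have /row_freeP[D KD] := krylov_free fA v0.
have eE : (degree_mxminpoly A).-1.+1 = degree_mxminpoly A.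
  by rewrite prednK // mxminpoly_nonconstant.
pose i0 : 'I_(degree_mxminpoly A) := cast_ord eE ord_max.
(* [D] is a right inverse of the Krylov matrix, so its last column is dual to the last row. *)
pose w := col i0 D.
have vw k : (k < degree_mxminpoly A)%N -> v *m A ^+ k *m w = (k == (degree_mxminpoly A).-1)%:R.
  move=> kd; have -> : v *m A ^+ k = row (Ordinal kd) (krylov A v) by rewrite rowK.
  rewrite /w colE mulmxA -row_mul KD -colE.
  apply/matrixP => a b; rewrite !ord1 [LHS]mxE [LHS]mxE [LHS]mxE -val_eqE /=.
  by case: eqP => _; rewrite mxE.
have tw k : (k < degree_mxminpoly A)%N -> telescope A (f *m v) k *m w = 0.
  elim: k => [|k IH] kd /=; first by rewrite mul0mx.
  rewrite mulmxDl -mulmxA IH ?mulmx0 ?add0r; last exact: ltnW.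
  rewrite -!mulmxA [v *m _]mulmxA vw; last exact: ltnW.
  have kd' : (k < (degree_mxminpoly A).-1)%N by rewrite -ltnS eE.
  by rewrite (ltn_eqF kd') mulmx0.
apply: contraNneq f0 => D0; apply/eqP.
have : divided_difference A (f *m v) *m w = 0 by rewrite D0 mul0mx.
rewrite /divided_difference size_mxminpoly big_ord_recr /= mulmxDl mulmx_suml.
rewrite big1 ?add0r => [|k _]; last by rewrite -scalemxAl tw ?scaler0.
have := mxminpoly_monic A; rewrite monicE lead_coefE size_mxminpoly /= => /eqP ->.
rewrite scale1r.
have -> : telescope A (f *m v) (degree_mxminpoly A) =
    A *m telescope A (f *m v) (degree_mxminpoly A).-1 + f *m v *m A ^+ (degree_mxminpoly A).-1.
  by rewrite -{1}eE.
rewrite mulmxDl -[A *m _ *m w]mulmxA tw ?eE // mulmx0 add0r.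
by rewrite -!mulmxA [v *m _]mulmxA vw ?eE // eqxx mulmx1.
Qed.

(** For non-zero [v] and [f], this X joins A to the rank-one matrix f v, as it commutes with
    both. *)
Definition annihilated A v f := exists X,
  [/\ X != 0, comm_mx A X, X *m (f *m v) = 0 & (f *m v) *m X = 0].

(** As [f] vanishes on v F[A], all products Z A^i Z are 0 for Z = f v, so Z annihilates its divided
    difference on both sides. *)
Lemma annihilated_fieldlike A v f : fieldlike A -> v != 0 -> f != 0 ->
  krylov A v *m f = 0 -> annihilated A v f.
Proof.
move=> fA v0 f0 Kf; exists (divided_difference A (f *m v)).
have Z0 i : f *m v *m A ^+ i *m (f *m v) = 0.
  have /submxP[c cE] : (v *m A ^+ i <= krylov A v)%MS.
    by apply/krylovP; exists 'X^i; rewrite rmorphXn /= horner_mx_X.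
  rewrite mulmxA -[f *m v *m _]mulmxA -[f *m _ *m f]mulmxA cE -[c *m _ *m f]mulmxA.
  by rewrite Kf !mulmx0 mul0mx.
split; first exact: divided_difference_neq0; first exact: divided_difference_comm.
  rewrite mulmx_suml big1 // => k _.
  by rewrite -scalemxAl telescope_mul ?scaler0.
rewrite mulmx_sumr big1 // => k _.
by rewrite -scalemxAr mul_telescope ?scaler0.
Qed.

Lemma kernel_vector m (M : 'M[F]_(m, n)) : (\rank M < n)%N ->
  exists2 x : 'cV[F]_n, x != 0 & M *m x = 0.
Proof.
move=> rM; have : cokermx M != 0 by rewrite -mxrank_eq0 mxrank_coker -lt0n subn_gt0.
case/matrix0Pn => i [j ij]; exists (col j (cokermx M)).
  by apply: contraNneq ij => /colP/(_ i); rewrite !mxE => ->.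
by rewrite colE mulmxA mulmx_coker mul0mx.
Qed.

(** X is x y^T with x killed by A and v, and with y^T killing A and f; the rank of A leaves room for
    both. *)
Lemma annihilated_low_rank A v f : (\rank A + 1 < n)%N -> annihilated A v f.
Proof.
move=> rA.
have [x x0 xE] : exists2 x : 'cV[F]_n, x != 0 & col_mx A v *m x = 0.
  apply: kernel_vector; rewrite -addsmxE; apply: leq_ltn_trans rA.
  apply: leq_trans (mxrank_adds_leqif A v) _.
  by rewrite leq_add2l rank_leq_row.
have [y y0 yE] : exists2 y : 'cV[F]_n, y != 0 & col_mx A^T f^T *m y = 0.
  apply: kernel_vector; rewrite -addsmxE; apply: leq_ltn_trans rA.
  apply: leq_trans (mxrank_adds_leqif A^T f^T) _.
  by rewrite mxrank_tr leq_add2l rank_leq_row.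
move: xE yE; rewrite !mul_col_mx => /eqP + /eqP; rewrite !col_mx_eq0.
case/andP=> /eqP Ax /eqP vx /andP[/eqP Ay /eqP fy].
have yA : y^T *m A = 0 by rewrite -[A]trmxK -trmx_mul Ay trmx0.
have yf : y^T *m f = 0 by rewrite -[f]trmxK -trmx_mul fy trmx0.
exists (x *m y^T); split.
- have [i xi] : exists i, x i 0 != 0.
    by case/matrix0Pn: x0 => i [j]; rewrite ord1; exists i.
  have [j yj] : exists j, y j 0 != 0.
    by case/matrix0Pn: y0 => j [k]; rewrite ord1; exists j.
  apply/matrix0Pn; exists i, j; rewrite mxE big_ord_recl big_ord0 addr0 mxE.
  by rewrite mulf_neq0.
- by rewrite /comm_mx mulmxA Ax mul0mx -mulmxA yA mulmx0.
- by rewrite -mulmxA [y^T *m _]mulmxA yf mul0mx mulmx0.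
- by rewrite -mulmxA [v *m _]mulmxA vx mul0mx mulmx0.
Qed.

Variable d : nat.
Hypothesis n_eq : n = d.*2.
Hypothesis d_gt1 : (1 < d)%N.
Hypothesis generator_neighbour : forall A,
  irreducible_poly (mxminpoly A) -> degree_mxminpoly A = n ->
  exists P, ~~ is_scalar_mx (horner_mx A P) /\
    (degree_mxminpoly (horner_mx A P) <= d)%N.

(** If m = p q properly, then p(A) q(A) = 0 and one factor has rank at most d. If m is irreducible,
    F[A] is a field, of degree n, where the hypothesis applies, or of degree at most n / 2. *)
Lemma good_neighbour A : ~~ is_scalar_mx A -> exists A',
  [/\ ~~ is_scalar_mx A', comm_mx A A' &
   (\rank A' + 1 < n)%N \/ fieldlike A' /\ (degree_mxminpoly A' <= d)%N].
Proof.
move=> nA.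
have [|irr|[p [q [pq ps qs]]]] := irreducible_or_factor (p := mxminpoly A).
- by rewrite size_mxminpoly ltnS mxminpoly_nonconstant.
- have fA := irreducible_fieldlike irr.
have le : (degree_mxminpoly A <= n)%N.
  rewrite -ltnS -size_mxminpoly -(size_char_poly A); apply: dvdp_leq.
    by rewrite monic_neq0 ?char_poly_monic.
  exact: mxminpoly_dvd_char.
move: le; rewrite leq_eqVlt => /orP[/eqP e|lt].
  have [P [nP dP]] := generator_neighbour irr e.
  exists (horner_mx A P); split=> //; first exact: comm_mx_horner.
  by right; split=> //; apply: fieldlike_horner.
exists A; split=> //; right; split=> //.
by rewrite -leq_double -n_eq; apply: fieldlike_degree.
have nz (r : {poly F}) : r != 0 -> (size r < size (mxminpoly A))%N -> horner_mx A r != 0.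
  move=> r0 rs; apply: contraTneq rs => rA; rewrite -leqNgt dvdp_leq //.
  exact: mxminpoly_min.
have : p * q != 0 by rewrite -pq monic_neq0 ?mxminpoly_monic.
rewrite mulf_eq0 negb_or => /andP[p0 q0].
have PQ : horner_mx A p *m horner_mx A q = 0.
  by have := mx_root_minpoly A; rewrite pq rmorphM.
have [r r0 rd] : exists2 r, horner_mx A r != 0 & (\rank (horner_mx A r) <= d)%N.
  have := mulmx0_rank_max PQ.
  case: (leqP (\rank (horner_mx A p)) d) => [?|? ?]; first by exists p; rewrite ?nz.
  by exists q; rewrite ?nz //; move: n_eq; lia.
have rn : (\rank (horner_mx A r) + 1 < n)%N by move: n_eq; lia.
exists (horner_mx A r); split; last by left.
- apply: contraTN rn => /is_scalar_mxP[a ra]; rewrite ra -leqNgt.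
  have a0 : a != 0 by apply: contraNneq r0 => a0; rewrite ra a0 raddf0.
  by rewrite mxrank_unit ?leq_addr // unitmxE det_scalar unitfE expf_neq0.
- exact: comm_mx_horner.
Qed.

(** The walk is A, A', X, f v, Y, B', B. The subspaces attached to A' and B' have dimension at most
    d and share [v], so their sum is proper and a non-zero [f] vanishes on it. *)
Lemma walk_of_length_six A B : ~~ is_scalar_mx A -> ~~ is_scalar_mx B ->
  exists X1 X2 X3 X4 X5, [/\ ~~ is_scalar_mx X1, ~~ is_scalar_mx X2, ~~ is_scalar_mx X3,
    ~~ is_scalar_mx X4 & ~~ is_scalar_mx X5] /\
    [/\ comm_mx A X1, comm_mx X1 X2, comm_mx X2 X3 & comm_mx X3 X4] /\
    comm_mx X4 X5 /\ comm_mx X5 B.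
Proof.
move=> nA nB.
have [A' [nA' cA hA]] := good_neighbour nA.
have [B' [nB' cB hB]] := good_neighbour nB.
pose v : 'rV[F]_n := delta_mx 0 0.
have v0 : v != 0 by apply/matrix0Pn; exists 0, 0; rewrite mxE eqxx oner_eq0.
have K C : (\rank C + 1 < n)%N \/ fieldlike C /\ (degree_mxminpoly C <= d)%N ->
    exists M : 'M[F]_n, [/\ (v <= M)%MS, (\rank M <= d)%N &
      forall f : 'cV_n, f != 0 -> M *m f = 0 -> annihilated C v f].
  case=> [rC|[fC dC]].
    exists <<v>>%MS; rewrite genmxE; split=> //.
      by rewrite mxrank_gen (leq_trans (rank_leq_row _)) // ltnW.
    by move=> f _ _; apply: annihilated_low_rank.
  exists <<krylov C v>>%MS; rewrite genmxE self_krylov mxrank_gen; split=> //.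
    exact: leq_trans (rank_leq_row _) dC.
  move=> f f0 Kf; apply: annihilated_fieldlike => //.
  have /submxP[D ->] : (krylov C v <= <<krylov C v>>)%MS by rewrite genmxE.
  by rewrite -mulmxA Kf mulmx0.
have [MA [vA rA aA]] := K _ hA.
have [MB [vB rB aB]] := K _ hB.
have [f f0 /eqP] : exists2 f : 'cV_n, f != 0 & col_mx MA MB *m f = 0.
  apply: kernel_vector; rewrite -addsmxE.
  have := mxrank_sum_cap MA MB.
  have : (0 < \rank (MA :&: MB))%N.
    rewrite lt0n mxrank_eq0; apply: contraNneq v0 => cap0.
    by rewrite -submx0 -cap0 sub_capmx vA.
  move: rA rB n_eq; lia.
rewrite mul_col_mx col_mx_eq0 => /andP[/eqP fA /eqP fB].
have [X [X0 cX XZ ZX]] := aA f f0 fA.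
have [Y [Y0 cY YZ ZY]] := aB f f0 fB.
have Z0 : f *m v != 0.
  have [i fi] : exists i, f i 0 != 0.
    by case/matrix0Pn: f0 => i [j]; rewrite ord1; exists i.
  apply/matrix0Pn; exists i, 0; rewrite mxE big_ord_recl big_ord0 addr0 mulf_neq0 //.
  by rewrite mxE eqxx oner_eq0.
have ns W : W != 0 -> W *m (f *m v) = 0 -> ~~ is_scalar_mx W.
  move=> W0 WZ; apply: contraNN W0 => /is_scalar_mxP[a Wa].
  move/eqP: WZ; rewrite Wa mul_scalar_mx scaler_eq0 (negPf Z0) orbF => /eqP ->.
  by rewrite raddf0.
have nZ : ~~ is_scalar_mx (f *m v).
  apply: contraNN X0 => /is_scalar_mxP[a Za].
  move/eqP: XZ; rewrite Za mul_mx_scalar scaler_eq0 => /orP[/eqP a0|//].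
  by case/eqP: Z0; rewrite Za a0 raddf0.
exists A', X, (f *m v), Y, B'; do !split=> //; try exact: ns.
- by rewrite /comm_mx XZ ZX.
- by rewrite /comm_mx YZ ZY.
Qed.

End CommutingNeighbours.

(** * Intermediate fields of extensions of degree 2d *)

Lemma irreducible_divisor (R : fieldType) (p : {poly R}) : (1 < size p)%N ->
  exists h : {poly R}, [/\ irreducible_poly h, h \is monic & h %| p].
Proof.
have [k] := ubnP (size p); elim: k p => // k IH p pk p1.
have [irr|[a [b [pE ap bp]]]] := irreducible_or_factor p1.
  have p0 := irredp_neq0 irr; have l0 : (lead_coef p)^-1 != 0 by rewrite invr_eq0 lead_coef_eq0.
  exists ((lead_coef p)^-1 *: p); split.
  - split=> [|q q1]; first by rewrite size_scale //; case: irr.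
    by rewrite dvdpZr // => /irr.2-/(_ q1) qp; rewrite (eqp_trans qp) // eqp_sym eqp_scale.
  - by rewrite monicE lead_coefZ mulVf // lead_coef_eq0.
  - by rewrite dvdpZl.
have ab0 : a * b != 0 by rewrite -pE -size_poly_gt0 ltnW.
move: (ab0); rewrite mulf_eq0 negb_or => /andP[a0 b0].
have a1 : (1 < size a)%N.
  rewrite ltnNge; apply: contraL bp => a1; rewrite -leqNgt pE size_mul //.
  by have : size a = 1%N; [apply/eqP; rewrite eqn_leq a1 size_poly_gt0|move=> ->].
have [|h [h1 h2 h3]] := IH a _ a1; first exact: leq_trans ap pk.
by exists h; split=> //; rewrite pE dvdp_mulr.
Qed.

Lemma dim_Fadjoin_sqrt (K : fieldType) (M : fieldExtType K) (E : {subfield M}) (x : M) :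
  x ^+ 2 \in E -> x \notin E -> \dim <<E; x>> = (2 * \dim E)%N.
Proof.
move=> xx nx; rewrite dim_Fadjoin; congr (_ * _)%N; apply/eqP.
rewrite eqn_leq; apply/andP; split; last first.
  by rewrite ltn_neqAle eq_sym adjoin_deg_eq1 nx.
have : minPoly E x %| 'X^2 - (x ^+ 2)%:P.
  apply: minPoly_dvdp; first by rewrite rpredB ?rpredX ?polyOverX // polyOverC.
  by rewrite /root !hornerE subrr.
move/dvdp_leq; rewrite size_minPoly size_XnsubC // ltnS; apply.
by rewrite -size_poly_gt0 size_XnsubC.
Qed.

Section Generators.

Variables (F : fieldType) (L : splittingFieldType F) (s : gal_of {:L}%AS) (d : nat).
Hypothesis d_prime : prime d.
Hypothesis d_odd : odd d.
Hypothesis s_order : #[s]%g = d.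
Hypothesis s_fixed : forall x : L, s x = x -> x \in 1%VS.
Variable e : L.
Hypothesis char_neq2 : (2 : L) != 0.
Hypothesis e_nonsquare : forall x : L, x ^+ 2 != e * s e.

Local Notation sg i := (s ^+ i)%g.
Local Notation baseP := (map_poly (in_alg L)).

Let e0 : e != 0.
Proof. by apply/eqP => e0; have := e_nonsquare 0; rewrite e0 mul0r expr0n eqxx. Qed.

(** Otherwise s^(2k)(e) is e times a square for all k. As d is odd, 2k = d + 1 is allowed and gives
    s(e), so e s(e) is a square. *)
Lemma skip_conjugate_nonsquare x : x ^+ 2 != e * sg 2 e.
Proof.
apply/eqP=> xe.
have sq k : exists y, sg (2 * k) e = e * y ^+ 2.
  elim: k => [|k [y IH]]; first by exists 1; rewrite expg0 gal_id expr1n mulr1.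
  exists (sg 2 y * (x / e)); rewrite mulnS addnC galpow_add IH rmorphM rmorphXn /=.
  rewrite !exprMn xe; have -> : sg 2 e = e * sg 2 e / e by rewrite mulrC mulKf.
  by field.
have [y] := sq (uphalf d); rewrite mul2n odd_uphalfK //.
rewrite -addn1 galpow_add -{1}s_order expg_order gal_id expg1 => se.
by have := e_nonsquare (e * y); rewrite se exprMn expr2 mulrA eqxx.
Qed.

Hypothesis maximality : forall m : {poly F},
  irreducible_poly (baseP m) -> size m = d.*2.+1 ->
  exists r : {poly L}, baseP m %| r ^+ 2 - (e * s e)%:P.

Lemma base_change_reducible (m : {poly F}) : size m = d.*2.+1 ->
  ~ irreducible_poly (baseP m).
Proof.
move=> m_size irr.
have [r mr] := maximality irr m_size.
have [M dimM [z zm _]] := irredp_FAdjoin irr.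
have ev (q : {poly L}) (c : L) : baseP m %| q ^+ 2 - c%:P ->
    (map_poly (in_alg M) q).[z] ^+ 2 = c%:A.
  case/dvdpP=> k /(congr1 (fun p => (map_poly (in_alg M) p).[z])).
  rewrite rmorphM hornerM /= (eqP zm) mulr0 rmorphB rmorphXn /= map_polyC !hornerE /=.
  by move/eqP; rewrite subr_eq0 => /eqP.
set eps := e * s e in mr *.
have eps0 : eps != 0 by rewrite mulf_neq0 ?fmorph_eq0.
(* [baseP m] is fixed by [s], so [r] may be conjugated. *)
have mr' : baseP m %| map_poly s r ^+ 2 - (s eps)%:P.
  have := mr; rewrite -(dvdp_map s) rmorphB rmorphXn /= map_polyC /=.
  rewrite (_ : map_poly s (baseP m) = baseP m) //.
  by have := map_gal_base s 1 m; rewrite expg1.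
have xE := ev _ _ mr; have yE := ev _ _ mr'.
set x := horner _ z in xE; set y := horner _ z in yE.
have x1 : x \notin 1%VS.
  apply/negP => /vlineP[a xa]; have := e_nonsquare a.
  rewrite -(inj_eq (fmorph_inj (in_alg M))) rmorphXn /= -/eps -xE xa.
  by rewrite eqxx.
(* If y = a + b x, then a b = 0 because x is not in L. With b = 0, s(e s(e)) is a square in L; with
   a = 0, e s^2(e) is one. *)
have y1 : y \notin <<1; x>>%VS.
  apply/negP => yx.
  have deg2 : adjoin_degree 1 x = 2%N.
    have := dim_Fadjoin 1 x; rewrite dimv1 muln1 => <-.
    by rewrite dim_Fadjoin_sqrt ?dimv1 // xE memvZ // mem1v.
  have p1 := Fadjoin_polyOver 1 x y; have psz := size_Fadjoin_poly 1 x y.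
  have := Fadjoin_poly_eq yx; rewrite deg2 in psz.
  rewrite (horner_coef_wide _ psz) !big_ord_recl big_ord0 /= expr0 expr1 mulr1 addr0.
  have /vlineP[a ->] := polyOverP p1 0%N; have /vlineP[b ->] := polyOverP p1 1%N.
  have inj : injective (in_alg M) := fmorph_inj _.
  move=> yab; have := yE; rewrite -yab.
  rewrite -[a%:A]/(in_alg M a) -[b%:A]/(in_alg M b) => E.
  have sqf (g : {rmorphism L -> M}) c : x ^+ 2 = g c ->
      g (a ^+ 2 + b ^+ 2 * c) + g (2 * a * b) * x = (g a + g b * x) ^+ 2.
    by move=> h; rewrite sqrrD exprMn h rmorphD !rmorphM rmorphMn rmorph1; ring.
  have z2 : (0 : L) ^+ 2 = 0 by rewrite expr0n.
  have {E} E : in_alg M (a ^+ 2 + b ^+ 2 * eps) + in_alg M (2 * a * b) * x = in_alg M (s eps).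
    by rewrite (sqf (in_alg M) eps).
  have [b0|b0] := eqVneq b 0.
    move: E; rewrite b0 z2 mul0r mulr0 rmorph0 mul0r !addr0 => /inj aE.
    have := e_nonsquare ((s^-1)%g a).
    by rewrite -(inj_eq (fmorph_inj s)) rmorphXn /= -galM ?memvf // mulVg gal_id aE eqxx.
  have [a0|a0] := eqVneq a 0.
    move: E; rewrite a0 z2 mulr0 mul0r rmorph0 mul0r add0r addr0 => /inj bE.
    have := skip_conjugate_nonsquare (b * e); rewrite exprMn.
    have se0 : s e != 0 by rewrite fmorph_eq0.
    rewrite -(inj_eq (mulIf se0)); move: bE; rewrite /eps rmorphM /= => bE.
    rewrite (_ : b ^+ 2 * e ^+ 2 * s e = b ^+ 2 * (e * s e) * e); last by ring.
    rewrite bE (_ : sg 2 e = s (s e)); last by rewrite -[2%N]/(1 + 1)%N galpow_add !expg1.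
    by rewrite (_ : _ * e = e * s (s e) * s e) ?eqxx //; ring.
  case/negP: x1.
  have ab0 : 2 * a * b != 0 by rewrite !mulf_neq0.
  have sol (g : {rmorphism L -> M}) t c w : c != 0 -> g t + g c * x = g w ->
      x = g (c^-1 * (w - t)).
    move=> c0 h; rewrite rmorphM rmorphB fmorphV -h [g t + _]addrC addrK mulKf //.
    by rewrite fmorph_eq0.
  rewrite (sol (in_alg M) _ _ _ ab0 E) /=.
  by rewrite memvZ // mem1v.
have dimxy : \dim <<<<1; x>>; y>> = 4%N.
  rewrite dim_Fadjoin_sqrt //; last by rewrite yE (subvP (sub1v _)) // memvZ // mem1v.
  by rewrite dim_Fadjoin_sqrt ?dimv1 // xE memvZ // mem1v.
have : (\dim <<<<1; x>>; y>> %| \dim {:M})%N by apply: field_dimS; apply: subvf.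
rewrite dimxy dimM size_map_poly m_size /= -muln2 -[4%N]/(2 * 2)%N dvdn_pmul2r //.
by rewrite dvdn2 d_odd.
Qed.

(** The characteristic polynomial of e over F: [s] permutes its factors cyclically. *)
Lemma conjugates_poly : exists mu : {poly F},
  size mu = d.+1 /\ baseP mu = \prod_(i < d) ('X - (sg i e)%:P).
Proof.
have [|mu muE] := fixed_poly s_fixed (p := \prod_(i < d) ('X - (sg i e)%:P)).
  rewrite rmorph_prod /=; under eq_bigr do rewrite map_polyXsubC /=.
  have d0 := prime_gt0 d_prime.
  rewrite -(prednK d0) big_ord_recr big_ord_recl /= mulrC; congr (_ * _).
    rewrite -[s _]/(s (sg d.-1 e)) -[X in s X]/(sg d.-1 e) -[s]expg1 -galpow_add.
    by rewrite addn1 prednK // -s_order expg_order expg0.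
  by apply: eq_bigr => i _; rewrite -{1}[s]expg1 -galpow_add addn1.
exists mu; split=> //; rewrite -(size_map_poly (in_alg L)) -muE.
by rewrite size_prod_XsubC /index_enum -enumT size_enum_ord.
Qed.

(** Over L, m has a proper irreducible factor h, moved by [s] since m is irreducible over F.
    Interpolation gives P congruent to e modulo h: P(A) is not scalar, as e is not in F, and is a
    root of the characteristic polynomial of e. *)
Lemma generator_neighbour (N : nat) (A : 'M[F]_N.+1) : N.+1 = d.*2 ->
  irreducible_poly (mxminpoly A) -> degree_mxminpoly A = N.+1 ->
  exists P, ~~ is_scalar_mx (horner_mx A P) /\
    (degree_mxminpoly (horner_mx A P) <= d)%N.
Proof.
move=> N_eq irr deg; set m := mxminpoly A in irr.
have m_size : size m = d.*2.+1 by rewrite size_mxminpoly deg N_eq.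
have m1 : (1 < size (baseP m))%N by rewrite size_map_poly; case: irr.
have [/base_change_reducible[]//|[a [b [mab sa sb]]]] := irreducible_or_factor m1.
have ab0 : a * b != 0 by rewrite -mab -size_poly_gt0 ltnW.
move: (ab0); rewrite mulf_eq0 negb_or => /andP[a0 b0].
have a1 : (1 < size a)%N.
  rewrite ltnNge; apply: contraL sb => a1; rewrite -leqNgt mab size_mul //.
  by have : size a = 1%N; [apply/eqP; rewrite eqn_leq a1 size_poly_gt0|move=> ->].
have [h [h_irr h_mon ha]] := irreducible_divisor a1.
have hm : h %| baseP m by rewrite mab dvdp_mulr.
have h_lt : (size h < size m)%N.
  by rewrite -(size_map_poly (in_alg L)); apply: leq_ltn_trans sa; apply: dvdp_leq.
have h_moved : map_poly s h != h.
  apply/eqP=> /(fixed_poly s_fixed)[h0 h0E].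
  move: hm h_lt; rewrite h0E dvdp_map size_map_poly => h0m.
  rewrite (eqp_size (irr.2 h0 _ h0m)) ?ltnn //.
  by rewrite -(size_map_poly (in_alg L)) -h0E gtn_eqF //; case: h_irr.
have [P hP] := conjugate_interpolation d_prime s_order s_fixed e h_irr h_mon h_moved.
(* As m is irreducible over F, a polynomial over F sharing the factor [h] with it is a multiple of
   m. *)
have common (q : {poly F}) : h %| baseP q -> m %| q.
  move=> hq; rewrite -[_ %| _]negbK -irreducible_poly_coprime //.
  rewrite -(coprimep_map (in_alg L)); apply/negP => /coprimepP/(_ h hm hq).
  by apply/negP; rewrite -size_poly_eq1 gtn_eqF //; case: h_irr.
exists P; split.
  apply/negP => /is_scalar_mxP[c Pc].
  have mP : m %| P - c%:P by apply: mxminpoly_min; rewrite rmorphB /= horner_mx_C Pc subrr.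
  have hPc : h %| baseP P - (c%:A)%:P.
    have := dvdp_trans hm (_ : baseP m %| baseP (P - c%:P)).
    by rewrite dvdp_map rmorphB /= map_polyC; apply.
  have : h %| (e - c%:A)%:P.
    have -> : (e - c%:A)%:P = (baseP P - (c%:A)%:P) - (baseP P - e%:P) :> {poly L}.
      by rewrite polyCB; ring.
    exact: dvdp_sub.
  move/dvdp_leq; rewrite polyC_eq0 size_polyC subr_eq0.
  have ec : e != c%:A by apply: contraNneq (e_moved e_nonsquare) => ->; apply/eqP; exact: (rmorph_alg s).
  by rewrite ec => /(_ isT); apply/negP; rewrite -ltnNge; case: h_irr.
have [mu [mu_size muE]] := conjugates_poly.
rewrite -ltnS -size_mxminpoly -mu_size; apply: dvdp_leq.
  by rewrite -size_poly_gt0 mu_size.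
have m_mu : m %| mu \Po P.
  apply: common; rewrite map_comp_poly /=; apply: dvdp_trans hP _.
  have /dvdpP[k ->] : 'X - e%:P %| baseP mu.
    rewrite muE; have d0 := prime_gt0 d_prime.
    by rewrite -(prednK d0) big_ord_recl expg0 gal_id dvdp_mulr.
  by rewrite comp_polyM dvdp_mull // comp_polyB comp_polyX comp_polyC.
apply: mxminpoly_min; rewrite horner_mx_comp.
exact/mxminpoly_minP.
Qed.

End Generators.

(** * The base field *)

Import Order.TTheory Num.Theory VectorInternalTheory.

Lemma rational_between (x y : algC) : x \is Num.real -> y \is Num.real -> x < y ->
  exists2 r : algC, r \in Crat & x < r < y.
Proof.
move=> xR yR xy; have yx : 0 < (y - x)^-1 by rewrite invr_gt0 subr_gt0.
pose k := (Num.floor (y - x)^-1 + 1)%R.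
have kR : (y - x)^-1 < k%:~R by apply: real_floorD1_gt; rewrite gtr0_real.
have k0 : 0 < k%:~R :> algC by apply: lt_trans kR.
have xkR : x * k%:~R \is Num.real by rewrite rpredM // gtr0_real.
have /andP[lo hi] := real_floor_itv xkR.
exists ((Num.floor (x * k%:~R) + 1)%:~R / k%:~R).
  by rewrite rpredM ?rpredV ?rpred_int.
rewrite ltr_pdivlMr // hi ltr_pdivrMr // intrD.
apply: le_lt_trans (_ : x * k%:~R + 1 < _); first by rewrite lerD2r.
rewrite addrC -ltrBrDr -mulrBl mulrC -ltr_pdivrMr ?subr_gt0 //.
by rewrite mul1r.
Qed.

Lemma size_quadratic (R : nzRingType) (c : R) : size ('X^2 - c *: 'X + 1) = 3%N.
Proof.
rewrite -addrA size_polyDl size_polyXn //.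
apply: leq_ltn_trans (size_polyD _ _) _; rewrite gtn_max ltnS size_polyN size_poly1 andbT.
by rewrite (leq_trans (size_scale_leq _ _)) ?size_polyX.
Qed.

(** Reducing at each step keeps the numbers small enough to compute. *)
Lemma two_powers_mod47 i : (2 ^ i %% 47 = iter i (fun m => 2 * m %% 47) 1)%N.
Proof. by elim: i => //= i IH; rewrite expnS -modnMmr IH. Qed.

(** * Cosines attached to the 47th roots of unity *)

Section Cyclotomic.

Variable z : algC.
Hypothesis z_prim : 47.-primitive_root z.

(** Twice the real part of [z ^+ k], as [z] has modulus one. *)
Definition cosine k := z ^+ k + z ^- k.

Let z0 : z != 0. Proof.
apply/eqP => z0; have /eqP := prim_expr_order z_prim.
by rewrite z0 expr0n eq_sym oner_eq0.
Qed.

Lemma cosineM2 k : cosine (2 * k) = cosine k ^+ 2 - 2.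
Proof.
have zk : z ^+ k != 0 by rewrite expf_neq0.
rewrite /cosine mulnC exprM; by field.
Qed.

Lemma cosine_mod k : cosine (k %% 47) = cosine k.
Proof. by rewrite /cosine prim_expr_mod. Qed.

Lemma cosine_opp k : (k <= 47)%N -> cosine (47 - k) = cosine k.
Proof.
move=> k47; have zk : z ^+ k != 0 by rewrite expf_neq0.
have e : z ^+ (47 - k) = z ^- k.
  by apply: (mulIf zk); rewrite mulVf // -exprD subnK // (prim_expr_order z_prim).
by rewrite /cosine e invrK addrC.
Qed.

Lemma cosine_real k : cosine k \is Num.real.
Proof.
have z_norm : `|z| = 1.
  apply/eqP; rewrite -(pexpr_eq1 (n := 47)) ?normr_ge0 //.
  by rewrite -normrX (prim_expr_order z_prim) normr1.
have zc : z^* = z^-1 by rewrite invC_norm z_norm expr1n invr1 mul1r.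
have ck : (z ^+ k)^* = z ^- k by rewrite rmorphXn /= zc exprVn.
by rewrite CrealE /cosine rmorphD /= fmorphV /= !ck invrK addrC.
Qed.

Lemma cosine1_neq2 : cosine 1 != cosine 2.
Proof.
rewrite -subr_eq0 /cosine expr1.
rewrite (_ : _ - _ = - ((z ^+ 3 - 1) * (z - 1)) / z ^+ 2); last by field.
rewrite !(mulf_eq0, invr_eq0, oppr_eq0, expf_eq0) (negPf z0) !orbF !subr_eq0.
rewrite -[X in _ || (X == 1)]expr1.
by rewrite -!(prim_order_dvd z_prim).
Qed.

(** A rational value c would make z a root of X^2 - c X + 1, but z has degree 46 over the
    rationals. *)
Lemma cosine1_irrational : cosine 1 \notin Crat.
Proof.
apply/negP => /CratP[c cE].
have [p [pE p_mon pP]] := minCpolyP z.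
pose q : {poly rat} := 'X^2 - c *: 'X + 1.
have : root (map_poly ratr q) z.
  rewrite /root /q rmorphD rmorphB /= map_polyXn map_polyZ map_polyX rmorph1.
  by rewrite !hornerE /= -cE /cosine expr1; apply/eqP; field.
have q_size : size q = 3%N by apply: size_quadratic.
have q0 : q != 0 by rewrite -size_poly_gt0 q_size.
rewrite pP => /(dvdp_leq q0); rewrite q_size.
rewrite -(size_map_poly (ratr : {rmorphism rat -> algC})) -pE (minCpoly_cyclotomic z_prim).
rewrite -(Cintr_Cyclotomic z_prim) size_map_inj_poly ?size_Cyclotomic ?rmorph0 //.
exact: intr_inj.
Qed.

Lemma separating_rational : exists2 r : algC, r \in Crat & (cosine 1 - r) * (cosine 2 - r) < 0.
Proof.
have [lt|gt|eq] := real_ltgtP (cosine_real 1) (cosine_real 2).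
- have [r rQ /andP[a b]] := rational_between (cosine_real _) (cosine_real _) lt.
  by exists r => //; rewrite pmulr_llt0 ?subr_gt0 ?subr_lt0.
- have [r rQ /andP[a b]] := rational_between (cosine_real _) (cosine_real _) gt.
  by exists r => //; rewrite pmulr_rlt0 ?subr_gt0 ?subr_lt0.
- by have := cosine1_neq2; rewrite eq eqxx.
Qed.

End Cyclotomic.

(** * Dickson polynomials *)

Section Dickson.

Variable R : comNzRingType.

(** Two consecutive Dickson polynomials, where D_n(w + 1/w) = w^n + w^-n. *)
Fixpoint dickson_pair n : {poly R} * {poly R} :=
  if n is n'.+1 then let (a, b) := dickson_pair n' in (b, 'X * b - a) else (2, 'X).
Definition dickson n := (dickson_pair n).1.

Lemma dicksonS n : dickson n.+2 = 'X * dickson n.+1 - dickson n.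
Proof. by rewrite /dickson /=; case: (dickson_pair n). Qed.

End Dickson.

Arguments dickson R n : simpl never.

Lemma horner_dickson (K : fieldType) (w : K) n : w != 0 ->
  (dickson K n).[w + w^-1] = w ^+ n + w ^- n.
Proof.
move=> w0; suff H : (dickson K n).[w + w^-1] = w ^+ n + w ^- n /\
  (dickson K n.+1).[w + w^-1] = w ^+ n.+1 + w ^- n.+1 by case: H.
elim: n => [|n [IH1 IH2]].
  by rewrite /dickson /= -polyC_natr hornerC hornerX !expr0 expr1 invr1.
split=> //; rewrite dicksonS hornerD hornerM hornerX hornerN IH1 IH2 !exprS.
have : w ^+ n != 0 by rewrite expf_neq0.
by move: (w ^+ n) => W W0; field; rewrite w0 W0.
Qed.

Lemma map_dickson (R S : comNzRingType) (f : {rmorphism R -> S}) n :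
  map_poly f (dickson R n) = dickson S n.
Proof.
suff H : map_poly f (dickson R n) = dickson S n /\ map_poly f (dickson R n.+1) = dickson S n.+1.
  by case: H.
elim: n => [|n [IH1 IH2]].
  by rewrite /dickson /= map_polyX rmorphMn rmorph1.
by split=> //; rewrite !dicksonS rmorphB rmorphM /= map_polyX IH1 IH2.
Qed.

(* 2 generates (Z/47)^* modulo -1: up to sign, every nonzero residue is a power of 2. *)
Lemma dickson_root (z x : algC) : 47.-primitive_root z -> (dickson _ 47).[x] = 2 ->
  x = 2 \/ exists2 i, (i < 23)%N & x = cosine z (2 ^ i).
Proof.
move=> z_prim.
have [w w0 ->] : exists2 w : algC, w != 0 & x = w + w^-1.
  have /closed_rootP[w] : size ('X^2 - x *: 'X + 1) != 1%N by rewrite size_quadratic.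
  rewrite /root !hornerE => /eqP we.
  have w0 : w != 0 by apply: contra_eq_neq we => ->; rewrite expr0n mulr0 subr0 add0r oner_eq0.
  exists w => //; apply: (mulfI w0); rewrite mulrDr divff //.
  by apply/eqP; rewrite -subr_eq0 -oppr_eq0; apply/eqP; rewrite -[RHS]we; ring.
rewrite horner_dickson // => e.
(* W + 1/W = 2 forces (W - 1)^2 = 0. *)
have w47 : w ^+ 47 = 1.
  have : w ^+ 47 != 0 by rewrite expf_neq0.
  move: (w ^+ 47) e => W e W0; apply/eqP; rewrite -subr_eq0 -sqrf_eq0.
  have -> : (W - 1) ^+ 2 = (W + W^-1 - 2) * W by field.
  by rewrite e subrr mul0r.
have /(prim_rootP z_prim)[k wk] := w47.
have -> : w + w^-1 = cosine z k by rewrite wk.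
have [k0|k0] := eqVneq (k : nat) 0%N; first by left; rewrite k0 /cosine expr0 invr1.
right.
pose pow2 i := iter i (fun m => 2 * m %% 47)%N 1%N.
have pow2E i : (2 ^ i %% 47 = pow2 i)%N by apply: two_powers_mod47.
have H : all (fun k => has (fun i => (pow2 i == k) || (pow2 i == 47 - k))%N (iota 0 23)) (iota 1 46).
  by vm_compute.
have /(allP H)/hasP[i] : (k : nat) \in iota 1 46 by rewrite mem_iota lt0n k0 ltn_ord.
rewrite mem_iota => /andP[_ i23] ik; exists i; first exact: i23.
rewrite -[RHS](cosine_mod z_prim) pow2E.
case/orP: ik => /eqP ->; first by [].
by rewrite (cosine_opp z_prim) ?(ltnW (ltn_ord k)).
Qed.

(** * Subfields of the algebraic numbers *)

Record subfieldC := SubfieldC {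
  subfieldC_pred : {pred algC};
  subfieldC_closed : divring_closed subfieldC_pred }.

Section SubfieldType.

Variable K : subfieldC.

HB.instance Definition _ :=
  GRing.isDivringClosed.Build algC (subfieldC_pred K) (subfieldC_closed K).

Record subC : predArgType := SubC { subC_val : algC; subC_valP : subC_val \in subfieldC_pred K }.

HB.instance Definition _ := [isSub for subC_val].
HB.instance Definition _ := [Choice of subC by <:].
HB.instance Definition _ := [SubChoice_isSubIntegralDomain of subC by <:].
HB.instance Definition _ := [SubIntegralDomain_isSubField of subC by <:].

Lemma subC_val_is_zmod_morphism : zmod_morphism subC_val. Proof. by []. Qed.
Lemma subC_val_is_monoid_morphism : monoid_morphism subC_val. Proof. by []. Qed.
HB.instance Definition _ :=
  GRing.isZmodMorphism.Build subC algC subC_val subC_val_is_zmod_morphism.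
HB.instance Definition _ :=
  GRing.isMonoidMorphism.Build subC algC subC_val subC_val_is_monoid_morphism.

(** Excluded middle decides membership, as the construction of minimal polynomials requires. *)
Lemma subC_decidable : decidable_embedding subC_val.
Proof. by move=> y; apply: pselect. Qed.

Lemma subC_valK x : x \in subfieldC_pred K -> exists a : subC, subC_val a = x.
Proof. by move=> Kx; exists (SubC Kx). Qed.

Lemma lift_poly (p : {poly algC}) : (forall i, p`_i \in subfieldC_pred K) ->
  exists q : {poly subC}, p = map_poly subC_val q.
Proof.
move=> Kp; have [f fE] := choice (fun i => subC_valK (Kp i)).
exists (\poly_(i < size p) f i); apply/polyP => i; rewrite coef_map coef_poly.
case: ltnP => [_|ip]; first by rewrite /= fE.
by rewrite nth_default // [RHS](rmorph0 subC_val).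
Qed.

Lemma subC_integral x : integralOver subC_val x.
Proof.
have [p [pE p_mon _]] := minCpolyP x.
have [|q qE] := @lift_poly (map_poly ratr p).
  by move=> i; rewrite coef_map /= rpred_rat.
by exists q; rewrite -?(map_monic subC_val) -qE ?map_monic // -pE root_minCpoly.
Qed.

Lemma subC_minpoly x : {p : {poly subC} |
  [/\ p \is monic, root (map_poly subC_val p) x & irreducible_poly p]}.
Proof. exact: minPoly_decidable_closure subC_decidable (subC_integral x). Qed.

Definition adjoin x : set algC := fun y => exists q : {poly subC}, y = (map_poly subC_val q).[x].

Lemma adjoin_closed x : divring_closed [pred y | `[< adjoin x y >]].
Proof.
split.
- by rewrite inE; exists 1; rewrite rmorph1 hornerC.
- move=> _ _ /[!inE] -[p ->] [q ->].
  by exists (p - q); rewrite rmorphB !hornerE.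
- move=> _ _ /[!inE] -[p ->] [q ->].
  have [q0|q0] := eqVneq (map_poly subC_val q).[x] 0.
    by exists 0; rewrite q0 invr0 mulr0 rmorph0 horner0.
  have [f [_ fx f_irr]] := subC_minpoly x.
  (* The Bezout relation expresses the inverse of q(x) as a polynomial in x. *)
  have /Bezout_eq1_coprimepP[[a b] /= ab] : coprimep f q.
    rewrite irreducible_poly_coprime //; apply: contraNN q0 => fq.
    by case/dvdpP: fq => k ->; rewrite rmorphM hornerM /= (rootP fx) mulr0.
  exists (p * b); rewrite rmorphM hornerM /=; congr (_ * _).
  apply: (mulIf q0); rewrite mulVf //.
  have := congr1 (fun g => (map_poly subC_val g).[x]) ab.
  by rewrite rmorphD !rmorphM rmorph1 /= hornerD !hornerM (rootP fx) mulr0 add0r hornerC.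
Qed.

Lemma adjoin_base x a : adjoin x (subC_val a).
Proof. by exists a%:P; rewrite map_polyC hornerC. Qed.

Lemma adjoin_gen x : adjoin x x.
Proof. by exists 'X; rewrite map_polyX hornerX. Qed.

End SubfieldType.

(** * A maximal subfield, by Zorn's lemma *)

Section MaximalSubfield.

Variables u eps : algC.

(** As [u] is algebraic, the values [p.[u]] fill A(u): the last condition says that [eps] is not a
    square in A(u). *)
Definition admissible (A : set algC) :=
  [/\ divring_closed [pred y | `[< A y >]], ~ A u &
      forall p : {poly algC}, (forall i, A p`_i) -> p.[u] ^+ 2 != eps].

Hypothesis rat_admissible : admissible [set x | x \in Crat]%classic.

Lemma maximal_admissible : exists A, admissible A /\ forall B, (A `<` B)%classic -> ~ admissible B.
Proof.
have [|A [PA Amax]] := @Zorn_bigcup algC (fun A => A = set0 \/ admissible A).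
  move=> C CP Ctot; set U := (\bigcup_(X in C) X)%classic.
  have [U0|Un] := pselect (U = set0); first by left.
  right.
  have [x0 [X0 CX0 X0x0]] : exists x, U x by apply/set0P/eqP.
  have adm X x : C X -> X x -> admissible X.
    by move=> CX Xx; case: (CP X CX) => // X0'; rewrite X0' in Xx.
  (* Finitely many elements of [U], such as the coefficients of a polynomial, lie in one member of
     the chain. *)
  have cover (r : seq algC) : (forall x, x \in r -> U x) ->
      exists X, [/\ C X, admissible X & forall x, x \in r -> X x].
    elim: r => [|x r IH] Ur; first by exists X0; split=> //; apply: adm X0x0.
    have [|X [CX aX Xr]] := IH; first by move=> y yr; apply: Ur; rewrite inE yr orbT.
    have [Y CY Yx] := Ur x (mem_head _ _).
    case: (Ctot X Y CX CY) => sub.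
      exists Y; split=> //; first exact: adm Yx.
      by move=> y; rewrite inE => /orP[/eqP -> //|/Xr/sub].
    exists X; split=> // y; rewrite inE => /orP[/eqP ->|/Xr //].
    exact: sub.
  split.
  - have two x y : U x -> U y -> exists X, [/\ C X, admissible X, X x & X y].
      move=> Ux Uy; have [|X [CX aX H]] := cover [:: x; y].
        by move=> w; rewrite !inE => /orP[]/eqP->.
      by exists X; split=> //; apply: H; rewrite !inE eqxx ?orbT.
    split.
    + have [[h1 _ _] _ _] := adm _ _ CX0 X0x0.
      by rewrite inE; exists X0 => //; move: h1; rewrite inE.
    + move=> x y /[!inE] Ux Uy.
      have [X [CX [[_ h2 _] _ _] Xx Xy]] := two _ _ Ux Uy.
      exists X => //; have := h2 x y; rewrite !inE => h.
      exact: h.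
    + move=> x y /[!inE] Ux Uy.
      have [X [CX [[_ _ h3] _ _] Xx Xy]] := two _ _ Ux Uy.
      exists X => //; have := h3 x y; rewrite !inE => h.
      exact: h.
  - by case=> X CX Xu; have [_ + _] := adm _ _ CX Xu; apply.
  - move=> p Up; have [|X [CX [[h1 h2 _] _ h] Xp]] := cover p.
      by move=> x /(nthP 0)[i _ <-]; apply: Up.
    apply: h => i; have [ip|ip] := ltnP i (size p); first by apply/Xp/mem_nth.
    (* Coefficients beyond the size are 0 = 1 - 1, which is in [X]. *)
    rewrite nth_default //; have := h2 1 1; rewrite !inE subrr => h.
    by apply: h; move: h1; rewrite inE.
exists A; case: PA => [A0|aA]; last first.
  by split=> // B AB aB; apply: (Amax B AB); right.
case: (Amax [set x | x \in Crat]%classic); last by right.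
rewrite A0; split; first exact: sub0set.
by move=> sub; have := sub 0 (rpred0 _).
Qed.

(** The alternatives are the two ways in which K(x) can fail to be admissible: it contains [u], or
    [eps] is a square in K(x)(u). *)
Lemma maximal_subfield : exists K : subfieldC,
  [/\ u \notin subfieldC_pred K,
      forall q : {poly subC K}, (map_poly (@subC_val K) q).[u] ^+ 2 != eps &
      forall x, x \notin subfieldC_pred K ->
        (exists q : {poly subC K}, (map_poly (@subC_val K) q).[x] = u) \/
        (exists (n : nat) (q : nat -> {poly subC K}),
          (\sum_(i < n) (map_poly (@subC_val K) (q i)).[x] * u ^+ i) ^+ 2 = eps)].
Proof.
have [A [[A_closed Au Asq] Amax]] := maximal_admissible.
pose K := SubfieldC A_closed; exists K; split.
- by apply/negP; rewrite inE.
- move=> q; apply: Asq => i; rewrite coef_map /=.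
  by have := subC_valP q`_i; rewrite inE.
move=> x; rewrite inE => /asboolP Ax.
case: (pselect (exists q : {poly subC K}, (map_poly (@subC_val K) q).[x] = u)) => [|nu]; first by left.
right; apply: contrapT => nsq.
apply: (Amax (@adjoin K x)).
  split.
    move=> y Ay; have [|a <-] := @subC_valK K y; first by rewrite inE.
    exact: adjoin_base.
  by move=> sub; apply/Ax/sub/adjoin_gen.
split; first exact: adjoin_closed.
  by case=> q uq; apply: nu; exists q.
move=> p /choice[q qE]; apply/eqP => pu; apply: nsq; exists (size p), q.
by rewrite -pu horner_coef; congr (_ ^+ 2); apply: eq_bigr => i _; rewrite -qE.
Qed.

End MaximalSubfield.

(** * The cyclic extension K(u) / K of degree 23 *)

Section CyclicSubextension.

Variables (z : algC) (K : subfieldC).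
Hypothesis z_prim : 47.-primitive_root z.
Local Notation u := (cosine z 1).
Hypothesis u_out : u \notin subfieldC_pred K.
Local Notation F := (subC K).
Local Notation iota := (@subC_val K).

Let z0 : z != 0.
Proof.
apply/eqP => z0; have /eqP := prim_expr_order z_prim.
by rewrite z0 expr0n eq_sym oner_eq0.
Qed.

Lemma root_irreducible_dvd (k : fieldType) (M : fieldType) (g : {rmorphism k -> M}) (f q : {poly k}) x :
  irreducible_poly f -> root (map_poly g f) x -> root (map_poly g q) x -> f %| q.
Proof.
move=> f_irr fx qx; rewrite -[_ %| _]negbK -irreducible_poly_coprime //.
rewrite -(coprimep_map g); apply/negP => /coprimep_root/(_ fx).
by rewrite (rootP qx) eqxx.
Qed.

(** [f] divides D_47 - 2, which vanishes at [u], so [dickson_root] applies to its roots. The root 2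
    would make [f] divide X - 2 and put [u] in K. *)
Lemma conjugate_cosine (f : {poly F}) : irreducible_poly f -> root (map_poly iota f) u ->
  forall w, root (map_poly iota f) w -> exists2 i, (i < 23)%N & w = cosine z (2 ^ i).
Proof.
move=> f_irr fu w fw.
have i2 : iota 2 = 2 := rmorph_nat _ 2.
have dickE n : map_poly iota (dickson F n - 2%:P) = dickson algC n - 2%:P.
  by rewrite rmorphB /= map_polyC (map_dickson iota); congr (_ - _%:P); exact: i2.
(* The index 47 is abstracted to keep unification from computing the polynomial. *)
have [N NE] : exists N, N = 47%N by exists 47%N.
have droot : forall x, (dickson algC N).[x] = 2 ->
    x = 2 \/ exists2 i, (i < 23)%N & x = cosine z (2 ^ i).
  by rewrite NE => x; apply: dickson_root.
have zN : z ^+ N = 1 by rewrite NE; apply: prim_expr_order.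
have dick x : root (map_poly iota (dickson F N - 2%:P)) x = ((dickson algC N).[x] == 2).
  by rewrite dickE /root hornerD hornerN hornerC subr_eq0.
have fd : f %| dickson F N - 2%:P.
  apply: (root_irreducible_dvd f_irr fu); rewrite dick.
  by rewrite /cosine expr1 horner_dickson // zN invr1.
have : (dickson algC N).[w] = 2.
  apply/eqP; rewrite -dick; case/dvdpP: fd => k ->.
  by rewrite rmorphM rootM fw orbT.
case/droot => // w2.
have f2 : f %| 'X - 2%:P.
  apply: (root_irreducible_dvd f_irr fw).
  by rewrite map_polyXsubC root_XsubC w2 -i2.
case/dvdpP: f2 => k /(congr1 (fun q => (map_poly iota q).[u])).
rewrite rmorphM hornerM /= (rootP fu) mulr0 map_polyXsubC !hornerE /= => /eqP.
rewrite subr_eq0 => /eqP u2; case/negP: u_out; rewrite u2.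
exact: (subC_valP (1 + 1)%R).
Qed.

(** The roots of the minimal polynomial of [u] are among the iterates of [u] under y^2 - 2, so
    adjoining [u] splits it. An automorphism is determined by the iterate to which it sends [u], and
    iterates compose by adding their indices modulo 23. *)
Lemma cyclic_extension : exists (L : splittingFieldType F) (j : {rmorphism L -> algC}) (x : L)
    (s : gal_of {:L}%AS),
  [/\ forall a : F, j a%:A = iota a, j x = u,
      forall y : L, exists q : {poly F}, y = (map_poly (in_alg L) q).[x],
      s x = x ^+ 2 - 2 &
      [/\ #[s]%g = 23%N, \dim {:L} = 23%N & forall y : L, s y = y -> y \in 1%VS]].
Proof.
have [f [f_mon fu f_irr]] := subC_minpoly K u.
have f0 := irredp_neq0 f_irr.
pose L0 : fieldExtType F := SubFieldExtType fu f_irr.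
pose j0 : {rmorphism L0 -> algC} := @subfx_inj _ _ iota u f.
pose x : L0 := subfx_root iota u f.
have j0x : j0 x = u by apply: subfx_inj_root.
have j0a (a : F) : j0 a%:A = iota a by apply: subfx_inj_base.
have genx (y : L0) : exists q : {poly F}, y = (map_poly (in_alg L0) q).[x].
  by have [q qE] := subfxEroot fu f0 y; exists q.
(* By the duplication formula these lift the numbers [cosine z (2 ^ i)] to [L0]. *)
pose v i := iter i (fun y : L0 => y ^+ 2 - 2) x.
have j0v i : j0 (v i) = cosine z (2 ^ i).
  elim: i => [|i IH] /=; first by rewrite expn0.
  by rewrite expnS cosineM2 // -IH rmorphB rmorphXn rmorphMn rmorph1.
have v0 : v 0%N = x by [].
have vS i : v i.+1 = v i ^+ 2 - 2 by [].
clearbody v.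
have map_j0 (q : {poly F}) : map_poly j0 (map_poly (in_alg L0) q) = map_poly iota q.
  by rewrite -map_poly_comp; apply: eq_map_poly => a /=; rewrite j0a.
pose p := map_poly (in_alg L0) f.
have [rs prs] : exists rs : seq L0, p = \prod_(y <- rs) ('X - y%:P).
  have [ws] := closed_field_poly_normal (map_poly iota f).
  rewrite (monicP (_ : map_poly iota f \is monic)) ?map_monic // scale1r => fE.
  have [rs rsE] : exists rs : seq L0, ws = map j0 rs.
    have : forall w, w \in ws -> exists y, j0 y = w.
      move=> w wws; have [|i _ ->] := conjugate_cosine f_irr fu (w := w).
        by rewrite fE root_prod_XsubC.
      by exists (v i).
    elim: ws {fE} => [|w ws IH] H; first by exists [::].
    have [y yw] := H w (mem_head _ _).
    have [|rs ->] := IH; first by move=> w' w'ws; apply: H; rewrite inE w'ws orbT.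
    by exists (y :: rs); rewrite /= yw.
  exists rs; apply: (map_poly_inj j0); rewrite map_j0 fE rsE big_map rmorph_prod.
  by apply: eq_bigr => y _; rewrite /= map_polyXsubC.
have px : root p x by rewrite -(fmorph_root j0) map_j0 j0x.
have ax : SplittingField.axiom L0.
  exists p; first by apply/polyOver1P; exists f.
  exists rs; first by rewrite prs eqpxx.
  apply/eqP; rewrite eqEsubv subvf /=; apply/subvP => y _.
  have [q ->] := genx y.
  have x_in : x \in <<1 & rs>>%VS by apply: seqv_sub_adjoin; rewrite -root_prod_XsubC -prs.
  apply: rpred_horner => //; apply/polyOverP => i; rewrite coef_map /=.
  by apply: rpredZ; apply: rpred1.
pose L : splittingFieldType F := HB.pack L0 (FieldExt_isSplittingField.Build F L0 ax).
pose j : {rmorphism L -> algC} := j0.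
have gx (g : gal_of {:L}%AS) : exists2 i, (i < 23)%N & g (x : L) = v i.
  have : root (map_poly iota f) (j (g (x : L))).
    rewrite -map_j0 fmorph_root -/p.
    have gp : map_poly g p = p by have := map_gal_base g 1 f; rewrite expg1.
    by rewrite -gp fmorph_root.
  by case/(conjugate_cosine f_irr fu) => i i23 /esym; rewrite -j0v => /fmorph_inj e; exists i.
have gal_ext (g h : gal_of {:L}%AS) : g (x : L) = h (x : L) -> g = h.
  move=> gh; apply/eqP/gal_eqP => y _; have [q ->] := genx y.
  have ev (t : gal_of {:L}%AS) : t ((map_poly (in_alg L) q).[x]) = (map_poly (in_alg L) q).[t (x : L)].
    rewrite -horner_map; congr (_.[_]).
    by have := map_gal_base t 1 q; rewrite expg1.
  by rewrite !ev gh.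
have gv (g : gal_of {:L}%AS) i : g (x : L) = v i -> forall m, g (v m : L) = v (m + i)%N.
  move=> gi; elim=> [|m IH]; first by rewrite v0 gi.
  by rewrite addSn !vS rmorphB rmorphXn rmorphMn rmorph1 /= IH.
have pow23 : (2 ^ 23 %% 47 = 1)%N by rewrite two_powers_mod47; vm_compute.
have v_mod i : v (i + 23)%N = v i.
  apply: (fmorph_inj j0); rewrite !j0v expnD -(cosine_mod z_prim) -modnMmr.
  by rewrite pow23 muln1 cosine_mod.
have gal1 : galois 1 {:L}.
  apply/and3P; split; [exact: sub1v| |exact: normalFieldf].
  apply/separableP => y _; rewrite -[separable_element _ _]negbK.
  apply/negP => /separablePn_pchar[q q_char _].
  have : q \in [pchar algC].
    case/andP: q_char => q_pr q0; rewrite inE q_pr /=.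
    by rewrite -(rmorph_nat j) (eqP q0) rmorph0.
  by rewrite Cpchar.
have fixG := galois_fixedField gal1.
have fix1 (y : L) : (forall g : gal_of {:L}%AS, g y = y) -> y \in 1%VS.
  move=> gy; have : y \in fixedField 'Gal({:L} / 1)%g.
    by apply/fixedFieldP; rewrite ?memvf.
  by rewrite fixG.
have [g gnx] : exists g : gal_of {:L}%AS, g (x : L) != x.
  apply/existsP; apply: contraT => /existsPn H.
  have /vlineP[a xa] : (x : L) \in 1%VS.
    by apply: fix1 => g; apply/eqP; have := H g; rewrite negbK.
  case/negP: u_out; rewrite -j0x xa j0a; exact: subC_valP.
have [i i23 gi] := gx g.
have i0 : (0 < i)%N by rewrite lt0n; apply: contra_neqN gnx => /eqP i0; rewrite gi i0 v0.
have [P [PE Pv]] : exists P, P = 23%N /\ forall m, v (m + P)%N = v m.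
  exact: (ex_intro _ 23%N (conj erefl v_mod)).
(* [i] is invertible modulo 23, so the power [k] of [g] sends x to [v 1], that is, x^2 - 2. *)
have [k l kl _] := egcdnP P i0.
have co : gcdn i P = 1%N.
  have p23 : prime 23 by [].
  rewrite PE.
  have /eqP : coprime i 23 by rewrite coprime_sym (prime_coprime i p23) (gtnNdvd i0 i23).
  by apply.
have v_mod' m r : v (r + m * P)%N = v r.
  elim: m => [|m IH]; first by rewrite mul0n addn0.
  by rewrite mulSn (addnC P) addnA Pv IH.
have gM (a b : gal_of {:L}%AS) (y : L) : (a * b)%g y = b (a y) := galM a b (memvf y).
have gk m : ((g ^+ m)%g (x : L)) = v (m * i)%N.
  elim: m => [|m IH]; first by rewrite expg0 gal_id mul0n v0.
  by rewrite expgSr gM IH (gv _ _ gi) mulSn addnC.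
pose s : gal_of {:L}%AS := (g ^+ k)%g.
have sx1 : s (x : L) = v 1.
  by rewrite /s gk kl co addnC v_mod'.
have sm m : ((s ^+ m)%g (x : L)) = v m.
  elim: m => [|m IH]; first by rewrite expg0 gal_id v0.
  by rewrite expgSr gM IH (gv _ _ sx1) addn1.
have s_order : #[s]%g = 23%N.
  have p23 : prime 23 by [].
  have s1 : #[s]%g != 1%N.
    rewrite order_eq1; apply: contra (cosine1_neq2 z_prim) => /eqP s1.
    have : v 1%N = x by rewrite -sx1 s1 gal_id.
    by move/(congr1 j); rewrite [j (v 1%N)]j0v j0x expn1 => ->.
  apply/(prime_nt_dvdP p23 s1).
  by rewrite -PE order_dvdn; apply/eqP/gal_ext; rewrite sm gal_id -[P]add0n Pv v0.
have all_s (h : gal_of {:L}%AS) : exists m, h = (s ^+ m)%g.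
  by have [m _ hm] := gx h; exists m; apply: gal_ext; rewrite sm.
exists L, j, x, s; split; [exact: j0a|exact: j0x|exact: genx|by rewrite sx1 vS v0|].
split; [exact: s_order| |].
  have := galois_dim gal1; rewrite dimv1 divn1 => ->.
  rewrite -s_order orderE; apply: eq_card => h; have [m ->] := all_s h.
  by rewrite mem_cycle gal_kHom; [exact: k1AHom|exact: sub1v].
move=> y sy; apply: fix1 => h; have [m ->] := all_s h.
elim: m => [|m IH]; first by rewrite expg0 gal_id.
by rewrite expgSr gM IH.
Qed.

End CyclicSubextension.

(** * Coordinates on L^2 and the choice of F, L, s and e *)

Lemma plane_coordinates (F : fieldType) (L : fieldExtType F) n : n = (\dim {:L}).*2 ->
  exists (enc : 'cV[L]_2 -> 'rV[F]_n) (dec : 'rV[F]_n -> 'cV[L]_2),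
    [/\ cancel enc dec, cancel dec enc &
        forall (a : F) u v, enc ((a%:A : L) *: u + v) = a *: enc u + enc v].
Proof.
rewrite dimvf -addnn => ->.
exists (fun v : 'cV[L]_2 => row_mx (v2r (v 0 0)) (v2r (v 1 0))).
exists (fun w : 'rV[F]_(dim L + dim L) => \col_i if i == 0 then r2v (lsubmx w) else r2v (rsubmx w)).
split.
- move=> v; apply/colP => i; rewrite mxE row_mxKl row_mxKr !v2rK.
  by case: i => [[|[|//]] i] /=; congr (v _ _); apply: val_inj.
- by move=> w; rewrite !mxE /= !r2vK hsubmxK.
- move=> a u v; rewrite !mxE !mulr_algl !linearP /=.
  by rewrite scale_row_mx add_row_mx.
Qed.

Lemma irreducible_no_root (k : fieldType) (p : {poly k}) a :
  irreducible_poly p -> (2 < size p)%N -> ~~ root p a.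
Proof.
move=> p_irr p2; rewrite root_factor_theorem; apply/negP => /p_irr.2.
by rewrite size_XsubC => /(_ isT)/eqp_size; rewrite size_XsubC => e; rewrite -e in p2.
Qed.

Lemma extension_data :
  exists (F : fieldType) (L : splittingFieldType F) (s : gal_of {:L}%AS) (e : L),
  [/\ #[s]%g = 23%N, \dim {:L} = 23%N, forall y : L, s y = y -> y \in 1%VS & [/\ (2 : L) != 0, forall y : L, y ^+ 2 != e * s e &
      forall m : {poly F}, irreducible_poly (map_poly (in_alg L) m) -> size m = (23.*2).+1 ->
        exists r : {poly L}, map_poly (in_alg L) m %| r ^+ 2 - (e * s e)%:P]].
Proof.
have [z z_prim] := C_prim_root_exists (isT : (0 < 47)%N).
have [r rQ r_sep] := separating_rational z_prim.
set u := cosine z 1 in r_sep; set eps := _ * _ in r_sep.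
have [|K [u_out sq_out K_max]] := @maximal_subfield u eps.
  split.
  - by split=> [|a b|a b]; rewrite !inE => //=; [apply: rpredB|apply: rpred_div].
  - by apply/negP; apply: cosine1_irrational.
  (* [eps] is negative, while a rational polynomial has a real value at the real number [u]. *)
  - move=> p pQ; rewrite gt_eqF // (lt_le_trans r_sep) // real_exprn_even_ge0 //.
    rewrite rpred_horner ?cosine_real //; apply/polyOverP => i.
    by apply: Creal_Crat; apply: pQ.
have [L [j [x [s [ja jx genx sx [s_order dimL s_fixed]]]]]] := cyclic_extension z_prim u_out.
have [c cr] : exists c : subC K, subC_val c = r.
  by apply: subC_valK; case/CratP: rQ => q ->; apply: rpred_rat.
have map_j (q : {poly subC K}) : map_poly j (map_poly (in_alg L) q) = map_poly (@subC_val K) q.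
  by rewrite -map_poly_comp; apply: eq_map_poly => a /=; rewrite ja.
pose e : L := x - c%:A.
have je : j (e * s e) = eps.
  have -> : s e = x ^+ 2 - 2 - c%:A.
    by rewrite /e rmorphB /= sx; congr (_ - _); exact: (rmorph_alg s).
  rewrite rmorphM /e !rmorphB rmorphXn rmorphMn rmorph1 /= !ja jx cr.
  by rewrite /eps -/u -[cosine z 2]/(cosine z (2 * 1)) cosineM2.
exists (subC K), L, s, e; split; [exact: s_order|exact: dimL|exact: s_fixed|split].
- by rewrite -(fmorph_eq0 j) rmorphMn rmorph1 pnatr_eq0.
- move=> y; have [q ->] := genx y; apply: contra_neq (sq_out q) => /(congr1 j).
  by rewrite je rmorphXn /= -horner_map jx map_j => ->.
move=> m m_irr m_size.
have m47 : size (map_poly (subC_val (K:=K)) m) != 1%N by rewrite size_map_poly m_size.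
have /closed_rootP[t mt] := m47.
have jmt : root (map_poly j (map_poly (in_alg L) m)) t by rewrite map_j.
have t_out : t \notin subfieldC_pred K.
  apply/negP => /subC_valK[a at_].
  have := irreducible_no_root a%:A m_irr; rewrite size_map_poly m_size => /(_ isT).
  by rewrite -(fmorph_root j) ja at_ jmt.
(* If u = q(t), reduce q modulo m: q - x vanishes at t and has degree below that of m, irreducible
   over L, so q = x and x is in F, which is absurd. *)
have [[q qt]|[n [q qE]]] := K_max t t_out.
  exfalso.
  have m0 : m != 0 by rewrite -size_poly_gt0 m_size.
  pose q' := q %% m.
  have q't : (map_poly (@subC_val K) q').[t] = u.
    rewrite -qt [in RHS](divp_eq q m) rmorphD rmorphM hornerD hornerM /= (rootP mt) mulr0.
    by rewrite add0r.
  have : map_poly (in_alg L) m %| map_poly (in_alg L) q' - x%:P.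
    apply: (root_irreducible_dvd m_irr jmt).
    by rewrite rmorphB /= map_j map_polyC /= jx /root !hornerE q't subrr.
  have [/eqP|nz] := eqVneq (map_poly (in_alg L) q' - x%:P) 0.
    rewrite subr_eq0 => /eqP/polyP/(_ 0%N); rewrite coef_map coefC /= => xE _.
    case/negP: u_out; rewrite -?/u /u -jx -xE ja; exact: subC_valP.
  move/(dvdp_leq nz); rewrite size_map_poly m_size leqNgt => /negP[].
  apply: leq_ltn_trans (size_polyD _ _) _; rewrite gtn_max size_polyN size_map_poly.
  by rewrite -m_size ltn_modp m0 (leq_ltn_trans (size_polyC_leq1 _)) // m_size.
(* The value of this polynomial at t is a square root of [eps]. *)
exists (\sum_(i < n) (x ^+ i)%:P * map_poly (in_alg L) (q i)).
apply: (root_irreducible_dvd m_irr jmt).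
rewrite rmorphB rmorphXn /= map_polyC /= je /root !hornerE subr_eq0; apply/eqP.
rewrite -qE rmorph_sum horner_sum; congr (_ ^+ 2); apply: eq_bigr => i _.
by rewrite rmorphM /= map_polyC map_j !hornerE /= rmorphXn /= jx mulrC.
Qed.

(* Connectedness and diameter of the commuting graph *)
Local Close Scope ring_scope.

Theorem mainTheorem1 :
  exists (F : fieldType) (n : nat),
    [/\ 0 < n,
        graph_connected (@commuting_graph F n)
      & is_diameter (@commuting_graph F n) (Some 6)].
Proof.
have [F [L [s [e [s_order dimL s_fixed [two_neq0 e_nonsquare e_max]]]]]] := extension_data.
have p23 : prime 23 by [].
(* 46 = 2d for the prime d = 23, which exceeds 20 as the shears require, and for which 47 = 2d + 1
   is prime. *)
exists F, 46%N.
have [enc [dec [encK decK enc_lin]]] := @plane_coordinates F L 46 (congr1 double (esym dimL)).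
have walk6 (A B : commuting_vertex F 46) :
    exists2 p, walk (@commuting_graph F 46) A B p & size p = 6%N.
  have gn (C : 'M[F]_46) := @generator_neighbour _ _ s 23 p23 isT s_order s_fixed e
    two_neq0 e_nonsquare e_max 45 C erefl.
  have [X1 [X2 [X3 [X4 [X5 [[n1 n2 n3 n4 n5] [[c1 c2 c3 c4] [c5 c6]]]]]]]] :=
    walk_of_length_six (d := 23) erefl isT gn (valP A) (valP B).
  exists [:: (exist _ X1 n1 : commuting_vertex F 46); exist _ X2 n2; exist _ X3 n3; exist _ X4 n4;
             exist _ X5 n5; B] => //.
  by split=> //=; rewrite /commuting_graph; do ![apply/andP; split=> //]; apply/comm_mxP.
have [A0 [B0 [nA nB no_walk]]] :=
  no_short_walk p23 s_order s_fixed isT encK decK enc_lin two_neq0 e_nonsquare.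
pose A : commuting_vertex F 46 := exist _ A0 nA.
pose B : commuting_vertex F 46 := exist _ B0 nB.
have far p : walk (@commuting_graph F 46) A B p -> (6 <= size p)%N.
  case=> pp pl; rewrite leqNgt; apply/negP => p6.
  (* Loops at [A] pad a shorter walk to length exactly five. *)
  pose q := nseq (5 - size p) A ++ p.
  have q_size : size q = 5%N by rewrite size_cat size_nseq subnK.
  have [q_path q_last] : walk (@commuting_graph F 46) A B q.
    have loop k : path (@commuting_graph F 46) A (nseq k A) /\ last A (nseq k A) = A.
      by elim: k => //= k [-> ->]; rewrite /commuting_graph /comm_mxb eqxx.
    have [lp ll] := loop (5 - size p)%N.
    by rewrite /walk /q cat_path last_cat lp ll.
  move: q_size q_path q_last; case: q => [|X1 [|X2 [|X3 [|X4 [|X5 [|]]]]]] //= _.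
  case/and5P => /comm_mxP c1 /comm_mxP c2 /comm_mxP c3 /comm_mxP c4 /andP[/comm_mxP c5 _] x5.
  apply: (no_walk _ _ _ _ (valP X1) (valP X2) (valP X3) (valP X4)) => //.
  by rewrite x5 in c5.
split=> //.
  by move=> U V; have [p pw _] := walk6 U V; exists p.
split.
  move=> U V [k|] /= dist; have [p pw p6] := walk6 U V; last by case: (dist p).
  by case: dist => _ k_min; rewrite -p6; apply: k_min.
(* The distance from [A] to [B] is exactly 6, so every bound is at least 6. *)
move=> b b_bound; apply: (b_bound A B); split; last exact: far.
exact: walk6.
Qed.
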